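(* Let $n,m\geq 1$ and let $u=(u^1,\dots,u^m):\mathbb{R}^n\to\mathbb{R}^m$ be a smooth map such that the matrix $g_{ij}=\delta_{ij}-\sum_{\alpha=1}^m u^\alpha_iu^\alpha_j$ is positive definite at every point of $\mathbb{R}^n$ (i.e. the graph of $u$ is space-like in pseudo-Euclidean space $\mathbb{R}^{n+m}$ with index $m$), and such that on all of $\mathbb{R}^n$ $$\sum_{i,j=1}^n g^{ij}u^{\alpha}_{ij}=-u^{\alpha}+x\cdot Du^{\alpha},\qquad \alpha=1,\dots,m,$$ where $(g^{ij})=(g_{ij})^{-1}$. Assume further that $u^\alpha(0)=0$ for all $\alpha$ and that $$\lim_{|x|\to\infty}\frac{\log\det(g_{ij}(x))}{|x|}=0.$$ Then the graph $M=\{(x,u(x)):x\in\mathbb{R}^n\}$ is a linear subspace of $\mathbb{R}^{n+m}$.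
   Context: Notation: $u^\alpha_i=\partial u^\alpha/\partial x_i$, $u^\alpha_{ij}=\partial^2u^\alpha/\partial x_i\partial x_j$, $Du^\alpha=(u^\alpha_1,\dots,u^\alpha_n)$, $\cdot$ is the standard inner product on $\mathbb{R}^n$. The pseudo-Euclidean metric of index $m$ on $\mathbb{R}^{n+m}$ is $ds^2=\sum_{i=1}^n dx_i^2-\sum_{\alpha=1}^m dx_{n+\alpha}^2$, and $(g_{ij})$ is the induced metric on the graph. The system says that the space-like graph $M$ satisfies the self-shrinker equation $H=-X^N$. *)

(* Defs.v *)
From HB Require Import structures.
From mathcomp Require Import all_boot all_order all_algebra.
From mathcomp Require Import all_classical all_reals all_analysis.
Set Implicit Arguments.
Unset Strict Implicit.
Unset Printing Implicit Defensive.
Import Order.TTheory GRing.Theory Num.Theory.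
Import numFieldNormedType.Exports.
Local Open Scope classical_set_scope.
Local Open Scope ring_scope.

(* The library norm `|x| on 'rV[R]_n is the sup norm, hence the Euclidean
   inner product and norm below; both norms induce the same topology. *)
Definition dotv (R : realType) (n : nat) (x y : 'rV[R]_n) : R :=
  \sum_(i < n) x 0 i * y 0 i.

Definition enorm (R : realType) (n : nat) (x : 'rV[R]_n) : R :=
  Num.sqrt (dotv x x).

(* The filter of the limits "|x| -> oo" on R^n: its sets are those containing
   some { x : |x| > r }. *)
Definition enorm_pinfty (R : realType) (n : nat) : set_system 'rV[R]_n :=
  filter_from [set: R] (fun r => [set x | r < enorm x]).

Global Instance enorm_pinfty_filter (R : realType) (n : nat) :
  Filter (@enorm_pinfty R n).
Proof.
apply: filter_from_filter; first by exists 0.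
move=> r s _ _; exists (Num.max r s) => // x /=.
by rewrite gt_max => /andP[].
Qed.

Definition partial (R : realType) (n : nat) (i : 'I_n) (f : 'rV[R]_n -> R) :
  'rV[R]_n -> R := fun x => 'D_(delta_mx 0 i) f x.

(* C^k: all partial derivatives of order <= k exist and are continuous. *)
Fixpoint Ck (R : realType) (n k : nat) (f : 'rV[R]_n -> R) : Prop :=
  continuous f /\
  if k is k'.+1 then
    forall i : 'I_n,
      (forall x, derivable f x (delta_mx 0 i)) /\ Ck k' (partial i f)
  else True.

Definition component (R : realType) (n m : nat) (u : 'rV[R]_n -> 'rV[R]_m)
  (a : 'I_m) : 'rV[R]_n -> R := fun x => u x 0 a.

Definition smooth (R : realType) (n m : nat) (u : 'rV[R]_n -> 'rV[R]_m) :
  Prop := forall (a : 'I_m) (k : nat), Ck k (component u a).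

Definition gradient (R : realType) (n : nat) (f : 'rV[R]_n -> R)
  (x : 'rV[R]_n) : 'rV[R]_n := \row_(i < n) partial i f x.

(* The metric induced on the graph of u, in the coordinates x, by the
   pseudo-Euclidean metric of index m on R^(n+m). *)
Definition graph_metric (R : realType) (n m : nat) (u : 'rV[R]_n -> 'rV[R]_m)
  (x : 'rV[R]_n) : 'M[R]_n :=
  \matrix_(i < n, j < n)
    ((i == j)%:R -
     \sum_(a < m) partial i (component u a) x * partial j (component u a) x).

Definition posdefmx (R : realType) (n : nat) (A : 'M[R]_n) : Prop :=
  A^T = A /\ forall v : 'rV[R]_n, v != 0 -> 0 < (v *m A *m v^T) 0 0.

Definition graph (R : realType) (n m : nat) (u : 'rV[R]_n -> 'rV[R]_m) :
  set 'rV[R]_(n + m) := [set row_mx x (u x) | x in [set: 'rV[R]_n]].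

(* Main.v *)
(** With L f = g^ij f_ij - x . Df, the equation says L u^a = - u^a, and the
    argument compares two functions.  For phi = - log det g, differentiating
    the equation gives L phi >= 2 |D^2 u|^2, all norms being taken with respect
    to g.  For z = |x|^2 - |u|^2 one finds L z = 2n - 2z.  Since the graph is
    space-like, |x| - |u| is nondecreasing along rays, so z >= c |x| for
    |x| >= 1, and the growth hypothesis becomes phi = o(z).

    Hence phi - e z attains its maximum for every e > 0, necessarily where
    z <= n, and letting e tend to 0 shows that phi attains a global maximum.
    If D^2 u did not vanish at some point y, then for a large and eps small the
    function phi + eps exp(- a |x - y|^2) would satisfy L > 0 on a large ball:
    near y because of the term |D^2 u|^2, and elsewhere because L of the
    Gaussian is positive away from y.  Subtracting a tiny multiple of z makes
    it attain its maximum inside this ball, which contradicts the maximum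
    principle.  So D^2 u = 0 and u is linear. *)
Require Import Defs.
From HB Require Import structures.
From mathcomp Require Import all_boot all_order all_algebra.
From mathcomp Require Import all_classical all_reals all_analysis.
From mathcomp Require Import perm ring lra.
Import Order.TTheory GRing.Theory Num.Theory.
Import numFieldNormedType.Exports.
Local Open Scope classical_set_scope.
Local Open Scope ring_scope.
Set Implicit Arguments.
Unset Strict Implicit.
Unset Printing Implicit Defensive.

(** * Directional derivatives and continuous partial derivatives *)

Section DirectionalDerivative.
Context {R : realType} {V : normedModType R}.
Implicit Types (f g : V -> R) (x v : V).

(** Frames are constant: the rows of [P] are orthonormal for the metric at a single point [p], and
    all derivatives are taken along these fixed vectors. The metric in such a frame is the identity
    only at [p], but that suffices to evaluate [L] there, without any connection or curvature. In
    [L phi] the differentiated equation removes the third derivatives of [u]; what then remains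
    besides [2 |D^2 u|^2] is a sum of squares, by the symmetry of [D^2 u]. No bound on the inverse
    metric holds on the whole space. Since [g <= 1], however, the inverse dominates the Euclidean
    metric everywhere, and its trace has to be bounded only on a ball that is fixed before the
    Gaussian is chosen. The unbounded drift has the favourable sign in [L] of the Gaussian up to a
    constant. Subtracting [e z] makes maxima exist at a cost of at most [2 n e] in [L], because
    [z >= 0]. The Gaussian takes the place of Hopf's strong maximum principle, so constancy of [phi]
    is never derived. *)

Lemma is_derive_line f x v (t df : R) :
  is_derive (x + t *: v) v f df <->
  is_derive t (1 : R) (fun s => f (x + s *: v)) df.
Proof.
have E : (fun h : R => h^-1 *: ((f \o shift (x + t *: v)) (h *: v) - f (x + t *: v)))
  = (fun h : R => h^-1 *: (((fun s => f (x + s *: v)) \o shift t) (h *: 1)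
       - f (x + t *: v))).
  apply/funext => h /=; congr (_ *: (f _ - _)).
  by rewrite [_%:A]mulr1 scalerDl addrCA.
by split=> -[d dE]; split; move: d dE; rewrite /derivable /derive E.
Qed.

Lemma is_derive_line0 f x v (df : R) :
  is_derive x v f df <-> is_derive (0 : R) (1 : R) (fun s => f (x + s *: v)) df.
Proof. by rewrite -is_derive_line scale0r addr0. Qed.

Lemma is_derive_translate f x v (a : V) (df : R) :
  is_derive (x + a) v f df -> is_derive x v (fun y => f (y + a)) df.
Proof.
move=> /is_derive_line0 H; apply/is_derive_line0.
by under eq_fun do rewrite addrAC.
Qed.

Lemma is_derive_add f g x v (df dg : R) : is_derive x v f df ->
  is_derive x v g dg -> is_derive x v (fun y => f y + g y) (df + dg).
Proof. exact: is_deriveD. Qed.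

Lemma is_derive_opp f x v (df : R) :
  is_derive x v f df -> is_derive x v (fun y => - f y) (- df).
Proof. exact: is_deriveN. Qed.

Lemma is_derive_sub f g x v (df dg : R) : is_derive x v f df ->
  is_derive x v g dg -> is_derive x v (fun y => f y - g y) (df - dg).
Proof. by move=> Hf Hg; apply: is_derive_add => //; apply: is_derive_opp. Qed.

Lemma is_derive_mul f g x v (df dg : R) : is_derive x v f df ->
  is_derive x v g dg -> is_derive x v (fun y => f y * g y) (df * g x + f x * dg).
Proof.
move=> Hf Hg; rewrite -[fun y => _]/(f * g).
have -> : df * g x + f x * dg = f x *: dg + g x *: df.
  by rewrite addrC; congr (_ + _); rewrite mulrC.
exact: is_deriveM.
Qed.

Lemma is_derive_const (c : R) x v : is_derive x v (fun _ => c) 0.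
Proof. exact: is_derive_cst. Qed.

Lemma is_derive_cmul (c : R) f x v (df : R) :
  is_derive x v f df -> is_derive x v (fun y => c * f y) (c * df).
Proof. exact: is_deriveZ. Qed.

Lemma is_derive_bigsum (T : Type) (r : seq T) (h : T -> V -> R) (dh : T -> R)
    x v : (forall i, is_derive x v (h i) (dh i)) ->
  is_derive x v (fun y => \sum_(i <- r) h i y) (\sum_(i <- r) dh i).
Proof.
move=> H; elim: r => [|a r IH].
  by rewrite big_nil; under eq_fun do rewrite big_nil; exact: is_derive_const.
rewrite big_cons; under eq_fun do rewrite big_cons.
exact: is_derive_add.
Qed.

Lemma is_derive_comp1 f (g : R -> R) x v (df dg : R) :
  is_derive x v f df -> is_derive (f x) 1 g dg ->
  is_derive x v (fun y => g (f y)) (dg * df).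
Proof.
move=> /is_derive_line0 Hf Hg; apply/is_derive_line0.
apply: (@is_derive1_comp R g (fun s => f (x + s *: v))) => //.
by rewrite scale0r addr0.
Qed.

Lemma differentiable_bigsum (T : Type) (r : seq T) (h : T -> V -> R) x :
  (forall i, differentiable (h i) x) ->
  differentiable (fun y => \sum_(i <- r) h i y) x.
Proof.
move=> H; elim: r => [|a r IH].
  by under eq_fun do rewrite big_nil; exact: differentiable_cst.
under eq_fun do rewrite big_cons.
exact: (differentiableD (H a) IH).
Qed.

Lemma differentiable_bigprod (T : Type) (r : seq T) (h : T -> V -> R) x :
  (forall i, differentiable (h i) x) ->
  differentiable (fun y => \prod_(i <- r) h i y) x.
Proof.
move=> H; elim: r => [|a r IH].
  by under eq_fun do rewrite big_nil; exact: differentiable_cst.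
under eq_fun do rewrite big_cons.
exact: (differentiableM (H a) IH).
Qed.

End DirectionalDerivative.

(** The segment is rescaled to [[0, 1]], so that neither the sign of [c] nor [c = 0] needs a
    separate case. *)
Lemma MVT_dir (R : realType) (V : normedModType R) (f : V -> R) (x v : V)
    (c : R) : (forall y, derivable f y v) ->
  exists t : R, (0 < t < 1) /\
    f (x + c *: v) - f x = c * 'D_v f (x + (t * c) *: v).
Proof.
move=> df.
pose k (s : R) := f (x + (s * c) *: v).
have dk (s : R) : is_derive s 1 k (c * 'D_v f (x + (s * c) *: v)).
  have H : is_derive (s * c) (1 : R) (fun s => f (x + s *: v))
             ('D_v f (x + (s * c) *: v)).
    exact: (is_derive_line f x v (s * c) _).1 (derivableP (df _)).
  have H2 : is_derive s (1 : R) (fun s : R => s * c) c.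
    have := @is_derive_mul R R (fun y => y) (fun _ => c) s 1 1 0
              (is_derive_id s 1) (is_derive_const c s 1).
    by rewrite mul1r mulr0 addr0.
  by apply: is_derive_eq; [exact: (is_derive_comp1 H2 H)|rewrite mulrC].
have [|t t01] := @MVT R k _ 0 1 ltr01 (fun s _ => dk s).
  apply: derivable_within_continuous => s _.
  by case: (dk s).
rewrite subr0 mulr1 /k mul0r mul1r scale0r addr0 => E.
by exists t.
Qed.

Lemma differential_of_bound (R : realType) (V W : normedModType R) (f : V -> W)
    (L : {linear V -> W}) (x : V) :
  continuous L ->
  (forall e : R, 0 < e ->
     \forall h \near 0, `|f (h + x) - f x - L h| <= e * `|h|) ->
  differentiable f x /\ 'd f x = L :> (V -> W).
Proof.
move=> cL H.
have oL : f \o shift x = cst (f x) + L +o_ 0 id.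
  apply/eqaddoP => _/posnumP[e]; near=> h.
  rewrite -[X in `|X|]/(f (h + x) - (f x + L h)) opprD addrA.
  by near: h; apply: H.
have dE := diff_unique cL oL.
by split=> //; apply/diff_locallyP; rewrite dE.
Unshelve. all: by end_near. Qed.

Lemma continuous_axpy (R : realType) (T : topologicalType) (c : R)
    (f g : T -> R) :
  continuous f -> continuous g -> continuous (fun x => c * f x + g x).
Proof.
move=> cf cg x.
have cc : {for x, continuous (fun _ : T => c)} by exact: cst_continuous.
exact: (continuousD (continuousM cc (cf x)) (cg x)).
Qed.

Lemma dist_le_of_close (R : realFieldType) (a b a' b' d : R) :
  `|a - b| <= d / 2 -> `|a' - b'| <= d / 2 -> b = b' -> `|a - a'| <= d.
Proof.
move=> H1 H2 E; rewrite -(subrK b a) -addrA; apply: le_trans (ler_normD _ _) _.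
by rewrite [leRHS]splitr lerD // E distrC.
Qed.

Section ContinuousPartials.
Context {R : realType} {n : nat}.
Implicit Types (f g : 'rV[R]_n -> R) (x v w : 'rV[R]_n).

(** The corners of a staircase from [0] to [x] with one step parallel to each axis; on each step the
    one-dimensional mean value theorem applies, and the increments telescope. *)
Definition trunc_row (k : nat) x : 'rV[R]_n :=
  \row_i (if (i < k)%N then x 0 i else 0).

Lemma trunc_row0 x : trunc_row 0 x = 0.
Proof. by apply/rowP => i; rewrite !mxE. Qed.

Lemma trunc_row_full x : trunc_row n x = x.
Proof. by apply/rowP => i; rewrite !mxE ltn_ord. Qed.

Lemma trunc_rowS (k : 'I_n) x :
  trunc_row k.+1 x = trunc_row k x + x 0 k *: delta_mx 0 k.
Proof.
apply/rowP => i; rewrite !mxE eqxx /= ltnS leq_eqVlt -val_eqE.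
case: (eqVneq (val i) (val k)) => [/val_inj ->|ik] /=; first by rewrite ltnn mulr1 add0r.
by rewrite mulr0 addr0.
Qed.

Lemma ler_coord_norm x i : `|x 0 i| <= `|x|.
Proof.
rewrite [leRHS]/Num.Def.normr /= mx_normrE.
exact: (le_bigmax _ (fun ij : 'I_1 * 'I_n => `|x ij.1 ij.2|) (0, i)).
Qed.

Lemma norm_row_le x (e : R) :
  0 <= e -> (forall i, `|x 0 i| <= e) -> `|x| <= e.
Proof.
move=> e0 H; rewrite [leLHS]/Num.Def.normr /= mx_normrE.
by apply: bigmax_le => // -[i j] _ /=; rewrite ord1.
Qed.

Lemma norm_delta_le1 (i : 'I_n) : `|delta_mx 0 i : 'rV[R]_n| <= 1.
Proof.
by apply: norm_row_le => // j; rewrite mxE eqxx /=; case: eqP; rewrite ?normr0 ?normr1.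
Qed.

Lemma increment_partials f x h :
  (forall i y, derivable f y (delta_mx 0 i)) ->
  exists y : 'I_n -> 'rV[R]_n, (forall i, `|y i - x| <= `|h|) /\
    f (x + h) - f x = \sum_i h 0 i * partial i f (y i).
Proof.
move=> df.
have H (i : 'I_n) : exists y, `|y - x| <= `|h| /\
    f (x + trunc_row i.+1 h) - f (x + trunc_row i h) = h 0 i * partial i f y.
  have [t [/andP[/ltW t0 /ltW t1] E]] := MVT_dir (x + trunc_row i h) (h 0 i) (df i).
  exists (x + trunc_row i h + (t * h 0 i) *: delta_mx 0 i).
  rewrite trunc_rowS addrA E; split => //.
  rewrite -[x + _ + _]addrA addrAC subrr add0r.
  apply: norm_row_le => // j; rewrite !mxE eqxx /=.
  case: (eqVneq j i) => [->|ji].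
    rewrite ltnn mulr1 add0r normrM ger0_norm //.
    apply: le_trans (ler_coord_norm h i).
    by rewrite ler_piMl.
  by rewrite mulr0 addr0; case: ifP => _; rewrite ?normr0 // ler_coord_norm.
have [y Hy] := choice H.
exists y; split=> [i|]; first by case: (Hy i).
have -> : \sum_i h 0 i * partial i f (y i) =
    \sum_(i < n) (f (x + trunc_row i.+1 h) - f (x + trunc_row i h)).
  by apply: eq_bigr => i _; case: (Hy i).
rewrite -(big_mkord xpredT (fun i => f (x + trunc_row i.+1 h) - f (x + trunc_row i h))).
by rewrite telescope_sumr // trunc_row_full trunc_row0 addr0.
Qed.

Lemma C1_differentiable f :
  (forall i x, derivable f x (delta_mx 0 i)) ->
  (forall i, continuous (partial i f)) ->
  forall x, differentiable f x /\
    (forall v, 'D_v f x = \sum_i v 0 i * partial i f x).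
Proof.
move=> df cf x.
pose L v := \sum_i v 0 i * partial i f x.
have Llin : linear L.
  move=> c v w; rewrite /L scaler_sumr -big_split; apply: eq_bigr => i _ /=.
  by rewrite !mxE mulrDl -mulrA.
pose Lm := GRing.isLinear.Build _ _ _ _ _ Llin.
pose LL : {linear 'rV[R]_n -> R} := HB.pack L Lm.
have cL : continuous LL.
  move=> y; apply: differentiable_continuous.
  apply: differentiable_bigsum => i.
  by apply: differentiableM; [exact: differentiable_coord|exact: differentiable_cst].
have [dfx dE] : differentiable f x /\ 'd f x = LL :> ('rV[R]_n -> R).
  apply: differential_of_bound cL _ => e e0.
  (* Each of the [n] coordinates contributes an error of at most this tolerance times the norm of
     [h]; the [+ 1] keeps the denominator positive for [n = 0]. *)
  have [d d0 Hd] : exists2 d : R, 0 < d & forall y, `|y - x| < d ->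
      forall i, `|partial i f y - partial i f x| <= e / (n%:R + 1).
    have : \forall y \near x, forall i,
        `|partial i f y - partial i f x| <= e / (n%:R + 1).
      pose F (i : 'I_n) : set 'rV[R]_n :=
        fun y => `|partial i f y - partial i f x| <= e / (n%:R + 1).
      suff HF i : \forall y \near x, F i y by exact: (filter_forall _ HF).
      rewrite /F.
      have /cvgrPdist_le := cf i x => /(_ (e / (n%:R + 1))).
      rewrite divr_gt0 ?ltr_wpDl // => /(_ isT).
      by apply: filterS => y; rewrite distrC.
    move=> /nbhs_ballP[d d0 H]; exists d => // y yx; apply: H.
    by rewrite -ball_normE /ball_ /= distrC.
  near=> h.
  have [y [yh E]] := increment_partials x h df.
  rewrite [X in `|X|](_ : _ =
      \sum_i h 0 i * (partial i f (y i) - partial i f x)); last first.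
    rewrite (addrC h) E -sumrB.
    by apply: eq_bigr => i _; rewrite mulrBr.
  apply: le_trans (ler_norm_sum _ _ _) _.
  apply: le_trans (_ : \sum_(i < n) `|h| * (e / (n%:R + 1)) <= _).
    apply: ler_sum => i _; rewrite normrM ler_pM //; first exact: ler_coord_norm.
    apply: Hd; apply: le_lt_trans (yh i) _.
    by near: h; exact: (@pseudometric_normed_Zmodule.nbhs0_lt R 'rV[R]_n d d0).
  rewrite sumr_const card_ord -(mulr_natr (`|h| * _)) -mulrA [leRHS]mulrC ler_wpM2l //.
  rewrite mulrAC ler_pdivrMr ?ltr_wpDl // ler_pM2l //.
  by rewrite lerDl.
by split => // v; rewrite deriveE // dE.
Unshelve. all: by end_near. Qed.

Lemma CkP k f : Ck k.+1 f -> [/\ continuous f,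
  forall i x, derivable f x (delta_mx 0 i) & forall i, Ck k (partial i f)].
Proof. by case=> cf H; split => // i; case: (H i). Qed.

Lemma Ck_continuous k f : Ck k f -> continuous f.
Proof. by case: k => [|k] []. Qed.

Lemma Ck_derivable k f : Ck k.+1 f -> forall x, differentiable f x.
Proof.
move=> /CkP[_ df cf] x.
by case: (C1_differentiable df (fun i => Ck_continuous (cf i)) x).
Qed.

Lemma Ck_deriveE k f : Ck k.+1 f ->
  forall v, 'D_v f = (fun x => \sum_i v 0 i * partial i f x).
Proof.
move=> /CkP[_ df cf] v; apply/funext => x.
by case: (C1_differentiable df (fun i => Ck_continuous (cf i)) x).
Qed.

Lemma Ck_cst k (c : R) : Ck k (fun _ : 'rV[R]_n => c).
Proof.
elim: k c => [|k IH] c; split; [exact: cst_continuous| by [] | exact: cst_continuous|].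
move=> i; split=> [x|]; first exact: derivable_cst.
rewrite (_ : partial i _ = fun _ => 0) //.
by apply/funext => x; rewrite /partial derive_cst.
Qed.

Lemma Ck_linear k (c : R) f g :
  Ck k f -> Ck k g -> Ck k (fun x => c * f x + g x).
Proof.
elim: k f g => [|k IH] f g Hf Hg.
  by split => //; apply: continuous_axpy; apply: Ck_continuous; eassumption.
have [cf df Cf] := CkP Hf; have [cg dg Cg] := CkP Hg.
have H i x := is_derive_add (is_derive_cmul c (derivableP (df i x)))
                (derivableP (dg i x)).
split; first exact: continuous_axpy.
move=> i; split=> [x|]; first by case: (H i x).
rewrite (_ : partial i _ = fun x => c * partial i f x + partial i g x).
  exact: IH.
by apply/funext => x; case: (H i x).
Qed.

Lemma Ck_lincomb k (T : Type) (r : seq T) (c : T -> R) (h : T -> 'rV[R]_n -> R) :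
  (forall i, Ck k (h i)) -> Ck k (fun x => \sum_(i <- r) c i * h i x).
Proof.
move=> H; elim: r => [|a r IH].
  by under eq_fun do rewrite big_nil; exact: Ck_cst.
by under eq_fun do rewrite big_cons; exact: Ck_linear.
Qed.

Lemma Ck_derive k f v : Ck k.+1 f -> Ck k ('D_v f).
Proof.
move=> H; rewrite (Ck_deriveE H); apply: Ck_lincomb => i.
by case: (CkP H).
Qed.

(* Both mixed derivatives are limits of the same second difference. *)
Lemma partialC f i j : Ck 2 f -> partial i (partial j f) = partial j (partial i f).
Proof.
move=> Hf; apply/funext => x.
have Hp k := let: And3 _ _ H := CkP Hf in H k.
have [_ df _] := CkP Hf.
have dpf k l y : derivable (partial k f) y (delta_mx 0 l) by case: (CkP (Hp k)).
have cpf k l : continuous (partial l (partial k f)).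
  by case: (CkP (Hp k)) => _ _ /(_ l) [].
pose e k : 'rV[R]_n := delta_mx 0 k.
have key k l (s : R) : 0 < s -> exists y, `|y - x| <= s *+ 2 /\
    f (x + s *: e k + s *: e l) - f (x + s *: e k) - f (x + s *: e l) + f x
    = s * s * partial l (partial k f) y.
  move=> s0.
  have dF y : is_derive y (e k) (fun y => f (y + s *: e l) - f y)
      (partial k f (y + s *: e l) - partial k f y).
    by apply: is_derive_sub; [apply: is_derive_translate|]; apply/derivableP/df.
  have dFy y : derivable (fun y => f (y + s *: e l) - f y) y (e k) by case: (dF y).
  have [t [/andP[/ltW t0 /ltW t1]]] := MVT_dir x s dFy.
  rewrite (@derive_val _ _ _ _ _ _ _ (dF _)) => E1.
  have [r [/andP[/ltW r0 /ltW r1] E2]] := MVT_dir (x + (t * s) *: e k) s (dpf k l).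
  exists (x + (t * s) *: e k + (r * s) *: e l); split.
    rewrite -[x + _ + _]addrA addrAC subrr add0r.
    apply: le_trans (ler_normD _ _) _.
    rewrite mulr2n lerD // normrZ normrM !ger0_norm ?(ltW s0) //.
      by rewrite -[leRHS]mulr1 ler_pM ?mulr_ge0 ?(ltW s0) //
        ?ler_piMl ?(ltW s0) // norm_delta_le1.
    by rewrite -[leRHS]mulr1 ler_pM ?mulr_ge0 ?(ltW s0) //
      ?ler_piMl ?(ltW s0) // norm_delta_le1.
  rewrite -mulrA -[s * partial l _ _]E2 -E1.
  by rewrite opprB addrA; ring.
apply/eqP; rewrite -subr_eq0 -normr_le0; apply/ler_addgt0Pl => d d0; rewrite addr0.
have /cvgrPdist_le/(_ (d / 2)) := cpf j i x; rewrite divr_gt0 // => /(_ isT) H1.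
have /cvgrPdist_le/(_ (d / 2)) := cpf i j x; rewrite divr_gt0 // => /(_ isT) H2.
have : \forall y \near x,
    `|partial i (partial j f) x - partial i (partial j f) y| <= d / 2 /\
    `|partial j (partial i f) x - partial j (partial i f) y| <= d / 2.
  exact: filterI H1 H2.
move=> /nbhs_ballP[r r0 H].
have r4 : 0 < r / 4 by rewrite divr_gt0.
have [y1 [d1 E1]] := key j i _ r4; have [y2 [d2 E2]] := key i j _ r4.
have small (y : 'rV[R]_n) : `|y - x| <= r / 4 *+ 2 -> ball x r y.
  move=> yr; rewrite -ball_normE /ball_ /= distrC; apply: le_lt_trans yr _.
  by rewrite -mulr_natr; lra.
have [A1 _] := H _ (small _ d1); have [_ A2] := H _ (small _ d2).
have EE : partial i (partial j f) y1 = partial j (partial i f) y2.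
  have r44 : r / 4 * (r / 4) != 0 by rewrite mulf_neq0 // gt_eqF.
  apply: (mulfI r44); apply: etrans (esym E1) _; apply: etrans _ E2.
  rewrite (addrAC x); congr (_ + f x).
  exact: addrAC.
rewrite /= in A1 A2.
exact: dist_le_of_close A1 A2 EE.
Qed.

Lemma deriveC f v w : Ck 2 f -> 'D_v ('D_w f) = 'D_w ('D_v f).
Proof.
move=> Hf.
have H2 a b : 'D_a ('D_b f) =
    fun x => \sum_i a 0 i * \sum_j b 0 j * partial i (partial j f) x.
  rewrite (Ck_deriveE (Ck_derive b Hf)) (Ck_deriveE Hf).
  apply/funext => x; apply: eq_bigr => i _; congr (_ * _).
  have [_ _ Cf] := CkP Hf.
  have := is_derive_bigsum (index_enum 'I_n) (fun j => is_derive_cmul (b 0 j)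
    (derivableP (let: And3 _ H _ := CkP (Cf j) in H i x))).
  by case.
apply: etrans (H2 v w) _; apply: etrans _ (esym (H2 w v)); apply/funext => x.
under eq_bigr do rewrite mulr_sumr.
rewrite exchange_big; apply: eq_bigr => i _; rewrite mulr_sumr.
by apply: eq_bigr => j _; rewrite mulrCA (partialC j i Hf).
Qed.

End ContinuousPartials.

(** * Second derivative test, derivatives of determinants *)

(** Were [d2] positive, ['D_v f] would be positive just beyond [p] in direction [v], and the mean
    value theorem would produce a value above the maximum. *)
Lemma second_derivative_test (R : realType) (V : normedModType R) (f : V -> R)
    (p v : V) (d2 : R) :
  (forall y, derivable f y v) -> (forall y, f y <= f p) ->
  is_derive p v ('D_v f) d2 -> 'D_v f p = 0 /\ d2 <= 0.
Proof.
move=> df fmax d2f.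
have D0 : 'D_v f p = 0.
  have dk (s : R) := (is_derive_line f p v s _).1 (derivableP (df _)).
  have H : is_derive (0 : R) (1 : R) (fun s => f (p + s *: v)) 0.
    apply: (@derive1_at_max _ (fun s : R => f (p + s *: v)) (-1) 1 0) => //.
    - by rewrite in_itv /= ltrN10 ltr01.
    - by move=> t _; rewrite scale0r addr0.
  by have [_] := (is_derive_line0 f p v 0).2 H.
split => //; rewrite leNgt; apply/negP => d20.
have [cv dE] := d2f.
have : (fun h : R => h^-1 *: (('D_v f \o shift p) (h *: v) - 'D_v f p)) @ 0^'
    --> d2 by rewrite -dE.
move=> /cvgrPdist_lt/(_ _ d20) /= [e /= e0 He].
have e2 : 0 < e / 2 by rewrite divr_gt0.
have [t [/andP[t0 t1] E]] := MVT_dir p (e / 2) df.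
have te0 : 0 < t * (e / 2) by rewrite mulr_gt0.
have := He (t * (e / 2)).
rewrite /ball_ /= sub0r normrN gtr0_norm // D0 subr0 [_ *: v + p]addrC => H.
have te : t * (e / 2) < e.
  apply: lt_trans (_ : e / 2 < e); first by rewrite gtr_pMl.
  by rewrite ltr_pdivrMr // ltr_pMr // ltr1n.
have {}H := H te (lt0r_neq0 te0).
have : 0 < 'D_v f (p + (t * (e / 2)) *: v).
  move: H; rewrite ltr_norml => /andP[_]; rewrite ltrBlDr -ltrBlDl subrr.
  by rewrite /GRing.scale /= pmulr_rgt0 ?invr_gt0.
have := fmax (p + (e / 2) *: v); rewrite -subr_le0 E pmulr_rle0 // => H1 H2.
by have := lt_le_trans H2 H1; rewrite ltxx.
Qed.

Section MatrixDerivatives.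
Context {R : realType} {V : normedModType R}.

Lemma is_derive_bigprod n (h : 'I_n -> V -> R) (dh : 'I_n -> R) (x v : V) :
  (forall i, is_derive x v (h i) (dh i)) ->
  is_derive x v (fun y => \prod_i h i y)
    (\sum_k \prod_i (if i == k then dh i else h i x)).
Proof.
elim: n h dh => [|n IH] h dh H.
  by under eq_fun do rewrite big_ord0; rewrite big_ord0; exact: is_derive_const.
under eq_fun do rewrite big_ord_recl.
rewrite big_ord_recl big_ord_recl /=.
have := is_derive_mul (H ord0) (IH _ _ (fun i => H (lift ord0 i))).
rewrite mulr_sumr; congr (is_derive _ _ _ (_ + _)).
by apply: eq_bigr => k _; rewrite big_ord_recl /=.
Qed.

(** Jacobi's formula: differentiating the Leibniz expansion replaces one row of [A] at a time by
    that of [D], and each resulting determinant is expanded along the replaced row. *)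
Lemma is_derive_det n (A : V -> 'M[R]_n) (D : 'M[R]_n) (x v : V) :
  (forall i j, is_derive x v (fun y => A y i j) (D i j)) ->
  is_derive x v (fun y => \det (A y)) (\sum_i \sum_j D i j * cofactor (A x) i j).
Proof.
move=> H.
pose B k : 'M[R]_n := \matrix_(i, j) (if i == k then D i j else A x i j).
have -> : \sum_i \sum_j D i j * cofactor (A x) i j = \sum_k \det (B k).
  apply: eq_bigr => k _; rewrite (expand_det_row _ k); apply: eq_bigr => j _.
  rewrite mxE eqxx; congr (_ * _); rewrite /cofactor; congr (_ * \det _).
  by apply/matrixP => a b; rewrite !mxE eq_sym (negbTE (neq_lift _ _)).
rewrite /determinant exchange_big /=.
have -> : \sum_(s : 'S_n) \sum_k (-1) ^+ s * \prod_i B k i (s i) =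
   \sum_(s : 'S_n) (-1) ^+ s * \sum_k \prod_i (if i == k then D i (s i) else A x i (s i)).
  apply: eq_bigr => s _; rewrite mulr_sumr; apply: eq_bigr => k _; congr (_ * _).
  by apply: eq_bigr => i _; rewrite mxE.
by apply: is_derive_bigsum => s; apply: is_derive_cmul; apply: is_derive_bigprod.
Qed.

Lemma differentiable_det n (A : V -> 'M[R]_n) (x : V) :
  (forall i j, differentiable (fun y => A y i j) x) ->
  differentiable (fun y => \det (A y)) x.
Proof.
move=> H; rewrite /determinant; apply: differentiable_bigsum => s.
apply: differentiableM; first exact: differentiable_cst.
exact: differentiable_bigprod.
Qed.

Lemma invmx_cofactor n (M : 'M[R]_n) i j : M \in unitmx ->
  invmx M i j = (\det M)^-1 * cofactor M j i.
Proof. by move=> Mu; rewrite /invmx Mu !mxE. Qed.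

Lemma differentiable_invmx n (A : V -> 'M[R]_n) (x : V) i j :
  (forall y, A y \in unitmx) ->
  (forall i j, differentiable (fun y => A y i j) x) ->
  differentiable (fun y => invmx (A y) i j) x.
Proof.
move=> Au dA; under eq_fun do rewrite invmx_cofactor //.
apply: differentiableM.
  apply: differentiableV; first exact: differentiable_det.
  by have := Au x; rewrite unitmxE unitfE.
rewrite /cofactor; apply: differentiableM; first exact: differentiable_cst.
by apply: differentiable_det => k l; under eq_fun do rewrite !mxE.
Qed.

(** Obtained by differentiating [A *m invmx A = 1]. An orthonormal frame reduces every use to
    [A p = 1], where the two factors [invmx (A p)] around [D] disappear. *)
Lemma is_derive_invmx1 n (A : V -> 'M[R]_n) (D : 'M[R]_n) (p v : V) i j :
  (forall y, A y \in unitmx) -> A p = 1%:M ->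
  (forall i j, differentiable (fun y => A y i j) p) ->
  (forall i j, is_derive p v (fun y => A y i j) (D i j)) ->
  is_derive p v (fun y => invmx (A y) i j) (- D i j).
Proof.
move=> Au A1 dA DA.
have H k l : is_derive p v (fun y => invmx (A y) k l)
    ('D_v (fun y => invmx (A y) k l) p).
  by apply: derivableP; apply: diff_derivable; apply: differentiable_invmx.
have E1 := is_derive_bigsum (index_enum 'I_n) (fun k => is_derive_mul (DA i k) (H k j)).
have E2 : is_derive p v (fun y => \sum_k A y i k * invmx (A y) k j) 0.
  have -> : (fun y => \sum_k A y i k * invmx (A y) k j) =
            (fun=> (1%:M : 'M[R]_n) i j).
    by apply/funext => y; rewrite -(mulmxV (Au y)) mxE.
  exact: is_derive_const.
have : \sum_k (D i k * invmx (A p) k j + A p i k * 'D_v (fun y => invmx (A y) k j) p) = 0.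
  by case: E1 => _ <-; case: E2.
rewrite A1 invmx1 big_split /=.
rewrite (bigD1 j) //= mxE eqxx mulr1 big1 ?addr0; last first.
  by move=> k kj; rewrite mxE (negbTE kj) mulr0.
rewrite (bigD1 i) //= mxE eqxx mul1r big1 ?addr0; last first.
  by move=> k ki; rewrite mxE eq_sym (negbTE ki) mul0r.
by move=> /eqP; rewrite addrC addr_eq0 => /eqP <-.
Qed.

Lemma is_derive_ln_det n (A : V -> 'M[R]_n) (D : 'M[R]_n) (x v : V) :
  0 < \det (A x) ->
  (forall i j, is_derive x v (fun y => A y i j) (D i j)) ->
  is_derive x v (fun y => ln (\det (A y)))
    (\sum_i \sum_j D i j * invmx (A x) j i).
Proof.
move=> A0 DA.
have := is_derive_comp1 (is_derive_det DA) (is_derive1_ln A0).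
congr is_derive; rewrite mulr_sumr; apply: eq_bigr => i _.
rewrite mulr_sumr; apply: eq_bigr => j _.
rewrite invmx_cofactor ?unitmxE ?unitfE ?gt_eqF // mulrCA.
by [].
Qed.

Lemma is_derive2_ln_det1 n (A : V -> 'M[R]_n) (D : V -> 'M[R]_n)
    (D2 : 'M[R]_n) (p v : V) :
  (forall y, 0 < \det (A y)) -> A p = 1%:M ->
  (forall i j, differentiable (fun y => A y i j) p) ->
  (forall y i j, is_derive y v (fun y => A y i j) (D y i j)) ->
  (forall i j, is_derive p v (fun y => D y i j) (D2 i j)) ->
  is_derive p v ('D_v (fun y => ln (\det (A y))))
    (\sum_i D2 i i - \sum_i \sum_j D p i j * D p j i).
Proof.
move=> A0 A1 dA DA DD.
have -> : 'D_v (fun y => ln (\det (A y))) =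
    (fun y => \sum_i \sum_j D y i j * invmx (A y) j i).
  by apply/funext => y; case: (is_derive_ln_det (A0 y) (DA y)).
have Au y : A y \in unitmx by rewrite unitmxE unitfE gt_eqF.
have := is_derive_bigsum (index_enum 'I_n) (fun i =>
  is_derive_bigsum (index_enum 'I_n) (fun j =>
  is_derive_mul (DD i j) (is_derive_invmx1 j i Au A1 dA (DA p)))).
congr is_derive; rewrite -sumrB; apply: eq_bigr => i _.
rewrite big_split /=; congr (_ + _).
  rewrite A1 invmx1 (bigD1 i) //= mxE eqxx mulr1 big1 ?addr0 //.
  by move=> k ki; rewrite mxE (negbTE ki) mulr0.
by rewrite -sumrN; apply: eq_bigr => j _; rewrite mulrN.
Qed.

End MatrixDerivatives.

(** The rows of [P] are an orthonormal basis for [A]. One step of symmetric Gaussian elimination,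
    the congruence by [T], splits off the corner [a] and leaves the Schur complement [S], to which
    induction applies. *)
Lemma posdef_frame (R : realType) (n : nat) (A : 'M[R]_n) : posdefmx A ->
  exists P : 'M[R]_n, P *m A *m P^T = 1%:M.
Proof.
elim: n A => [|n IH] A.
  by exists 1%:M; apply/matrixP => -[].
rewrite -[n.+1]/(1 + n)%N in A * => -[As Ap].
set a := A (lshift n 0) (lshift n 0).
set c := dlsubmx A.
have EA : A = block_mx a%:M c^T c (drsubmx A).
  rewrite -[LHS]submxK; congr block_mx.
    by rewrite [LHS]mx11_scalar !mxE.
  by rewrite /c -{1}As trmx_dlsub.
set S := drsubmx A - a^-1 *: (c *m c^T).
have a0 : 0 < a.
  have := Ap (row_mx 1%:M 0).
  rewrite EA tr_row_mx mul_row_block mul_row_col !mul0mx !addr0 trmx0 mulmx0 addr0.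
  rewrite trmx1 mulmx1 mul1mx mxE eqxx; apply.
  apply/eqP => /(congr1 lsubmx); rewrite row_mxKl => /matrixP/(_ 0 0).
  by rewrite !mxE eqxx => /eqP; rewrite oner_eq0.
pose T : 'M[R]_(1 + n) := block_mx 1%:M 0 (- a^-1 *: c) 1%:M.
have TA : T *m A *m T^T = block_mx a%:M 0 0 S.
  rewrite EA /T tr_block_mx !mulmx_block !trmx1 trmx0 !mul1mx !mul0mx !addr0.
  rewrite !mulmx0 !mulmx1 !addr0 mul_mx_scalar scalerA mulrN divff ?gt_eqF //.
  rewrite scaleN1r addNr mul0mx add0r mul_scalar_mx linearZ /= scalerA mulrN.
  rewrite divff ?gt_eqF // scaleN1r addNr.
  by rewrite /S addrC -scalemxAl scaleNr.
have Sp : posdefmx S.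
  split.
    rewrite /S linearB /= linearZ /= trmx_mul trmxK; congr (_ - _).
    by rewrite trmx_drsub As.
  move=> v v0.
  (* On this vector the form [A] takes the value of [S] on [v], so [S] inherits positivity. *)
  have := Ap (row_mx 0 v *m T).
  rewrite trmx_mul -!mulmxA [T *m _]mulmxA [T *m A *m _]mulmxA TA mulmxA.
  rewrite tr_row_mx !mul_row_block mul_row_col !trmx0 !mul0mx !mulmx0 mulmx1 !add0r.
  rewrite mulmxA; apply.
  apply: contraNneq v0 => /(congr1 rsubmx); rewrite row_mxKr => ->.
  by rewrite linear0.
have [Q QE] := IH _ Sp.
pose s := Num.sqrt a.
have s0 : s != 0 by rewrite gt_eqF // sqrtr_gt0.
exists (block_mx (s^-1)%:M 0 0 Q *m T).
rewrite trmx_mul -!mulmxA [T *m _]mulmxA [T *m A *m _]mulmxA TA.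
rewrite tr_block_mx !mulmx_block !trmx0 !mul0mx !mulmx0 !addr0 !add0r !mulmx0.
rewrite [Q *m _]mulmxA QE tr_scalar_mx -!scalar_mxM.
have -> : s^-1 * (a * s^-1) = 1.
  by rewrite mulrCA -invfM -expr2 sqr_sqrtr ?(ltW a0) // divff ?gt_eqF.
by rewrite -scalar_mx_block.
Qed.

(** * Euclidean norm *)

Section EuclideanNorm.
Context {R : realType} {n : nat}.
Implicit Types (x y : 'rV[R]_n) (c : R).

Lemma cauchy_schwarz_sum (T : Type) (r : seq T) (a b : T -> R) :
  (\sum_(i <- r) a i * b i) ^+ 2 <=
  (\sum_(i <- r) a i ^+ 2) * (\sum_(i <- r) b i ^+ 2).
Proof.
set A := \sum_(i <- r) a i ^+ 2; set B := \sum_(i <- r) b i ^+ 2.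
set C := \sum_(i <- r) a i * b i.
have [B0|B0] := eqVneq B 0.
  suff -> : C = 0 by rewrite expr0n B0 mulr0.
  rewrite /C; elim: r @A @B @C B0 => [|k r IH] /=; first by rewrite !big_nil.
  rewrite !big_cons => /eqP; rewrite paddr_eq0 ?sqr_ge0 ?sumr_ge0 //; last first.
    by move=> *; exact: sqr_ge0.
  by rewrite sqrf_eq0 => /andP[/eqP -> /eqP /IH ->]; rewrite mulr0 addr0.
have Bp : 0 < B by rewrite lt_def B0 sumr_ge0 // => *; exact: sqr_ge0.
have : 0 <= \sum_(i <- r) (B * a i - C * b i) ^+ 2.
  by apply: sumr_ge0 => *; exact: sqr_ge0.
have -> : \sum_(i <- r) (B * a i - C * b i) ^+ 2 = B * (A * B - C ^+ 2).
  rewrite (eq_bigr (fun i => B ^+ 2 * a i ^+ 2 + (- (2 * B * C)) * (a i * b i) +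
    C ^+ 2 * b i ^+ 2)); last by move=> i _; ring.
  by rewrite !big_split /= -!mulr_sumr -/A -/B -/C; ring.
by rewrite pmulr_rge0 // subr_ge0.
Qed.

Lemma dotv_ge0 x : 0 <= dotv x x.
Proof. by apply: sumr_ge0 => i _; rewrite -expr2 sqr_ge0. Qed.

Lemma dotv_eq0 x : (dotv x x == 0) = (x == 0).
Proof.
apply/eqP/eqP => [|->]; last by rewrite /dotv big1 // => i _; rewrite mxE mulr0.
move=> /eqP; rewrite psumr_eq0 => [/allP H|i _]; last by rewrite -expr2 sqr_ge0.
apply/rowP => i; rewrite mxE; apply/eqP.
by have := H i (mem_index_enum _); rewrite /= -expr2 sqrf_eq0.
Qed.

Lemma dotv00 : dotv (0 : 'rV[R]_n) 0 = 0.
Proof. by apply/eqP; rewrite dotv_eq0. Qed.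

Lemma dotvC x y : dotv x y = dotv y x.
Proof. by apply: eq_bigr => i _; rewrite mulrC. Qed.

Lemma dotvDr x y z : dotv x (y + z) = dotv x y + dotv x z.
Proof. by rewrite /dotv -big_split; apply: eq_bigr => i _; rewrite mxE mulrDr. Qed.

Lemma dotvZr c x y : dotv x (c *: y) = c * dotv x y.
Proof. by rewrite /dotv mulr_sumr; apply: eq_bigr => i _; rewrite mxE mulrCA. Qed.

Lemma dotvDl x y z : dotv (y + z) x = dotv y x + dotv z x.
Proof. by rewrite !(dotvC _ x) dotvDr. Qed.

Lemma dotvZl c x y : dotv (c *: y) x = c * dotv y x.
Proof. by rewrite !(dotvC _ x) dotvZr. Qed.

Lemma dotv_mulmx x y : dotv x y = (x *m y^T) 0 0.
Proof. by rewrite mxE; apply: eq_bigr => i _; rewrite mxE. Qed.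

Lemma dotvBl x y z : dotv (y - z) x = dotv y x - dotv z x.
Proof. by rewrite -scaleN1r dotvDl dotvZl mulN1r. Qed.

Lemma dotvBr x y z : dotv x (y - z) = dotv x y - dotv x z.
Proof. by rewrite -scaleN1r dotvDr dotvZr mulN1r. Qed.

(** This controls the drift term in [L] of a Gaussian centred at [y] by a constant independent of
    [x]. *)
Lemma dotv_sub_ge x y : - dotv y y <= dotv (x - y) x.
Proof.
have := dotv_ge0 x; have := dotv_ge0 (x - y); have := dotv_ge0 y.
rewrite !dotvBl !dotvBr (dotvC y x).
by move: (dotv x x) (dotv x y) (dotv y y) => a b c; lra.
Qed.

Lemma enorm_ge0 x : 0 <= enorm x.
Proof. exact: sqrtr_ge0. Qed.

Lemma enorm_sqr x : enorm x ^+ 2 = dotv x x.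
Proof. by rewrite sqr_sqrtr ?dotv_ge0. Qed.

Lemma dotv_le_enorm x y : dotv x y <= enorm x * enorm y.
Proof.
apply: le_trans (ler_norm _) _.
rewrite -(@ler_pXn2r _ 2) ?nnegrE ?mulr_ge0 ?enorm_ge0 ?normr_ge0 //.
rewrite real_normK ?num_real //.
rewrite exprMn !enorm_sqr.
exact: (cauchy_schwarz_sum (index_enum 'I_n) (x 0) (y 0)).
Qed.

Lemma enormD x y : enorm (x + y) <= enorm x + enorm y.
Proof.
rewrite -(@ler_pXn2r _ 2) ?nnegrE ?addr_ge0 ?enorm_ge0 //.
rewrite enorm_sqr dotvDl !dotvDr (dotvC y x) sqrrD !enorm_sqr.
by have := dotv_le_enorm x y; lra.
Qed.

Lemma enormZ c x : enorm (c *: x) = `|c| * enorm x.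
Proof.
by rewrite /enorm dotvZl dotvZr mulrA -expr2 sqrtrM ?sqr_ge0 // sqrtr_sqr.
Qed.

Lemma normr_le_enorm x : `|x| <= enorm x.
Proof.
apply: norm_row_le => [|i]; first exact: enorm_ge0.
rewrite -(@ler_pXn2r _ 2) ?nnegrE ?enorm_ge0 ?normr_ge0 //.
rewrite real_normK ?num_real // enorm_sqr /dotv.
rewrite (bigD1 i) //= -expr2 lerDl sumr_ge0 // => j _.
by rewrite -expr2 sqr_ge0.
Qed.

Lemma differentiable_dotv (V : normedModType R) (f g : V -> 'rV[R]_n) (x : V) :
  (forall i, differentiable (fun y : V => f y 0 i) x) ->
  (forall i, differentiable (fun y : V => g y 0 i) x) ->
  differentiable (fun y : V => dotv (f y) (g y)) x.
Proof. by move=> Hf Hg; apply: differentiable_bigsum => i; apply: differentiableM. Qed.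

Lemma is_derive_coord x v (i : 'I_n) :
  is_derive x v (fun y : 'rV[R]_n => y 0 i) (v 0 i).
Proof.
apply/is_derive_line0.
have := is_derive_add (is_derive_const (x 0 i) (0 : R) (1 : R))
  (is_derive_cmul (v 0 i) (is_derive_id (0 : R) (1 : R))).
rewrite add0r mulr1; congr is_derive; apply/funext => s.
by rewrite !mxE mulrC.
Qed.

Lemma continuous_dotv : continuous (fun x : 'rV[R]_n => dotv x x).
Proof.
move=> x; apply: differentiable_continuous.
by apply: differentiable_dotv => i; apply: differentiable_coord.
Qed.

Lemma compact_eball (r : R) : compact [set x : 'rV[R]_n | dotv x x <= r].
Proof.
apply: bounded_closed_compact.
  exists (Num.sqrt r); split; first exact: num_real.
  move=> M rM x /= xr; apply: le_trans (normr_le_enorm x) _.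
  by apply: le_trans (ltW rM); apply: ler_wsqrtr.
exact: ((continuous_closedP _).1 continuous_dotv _ (@closed_le _ r)).
Qed.

Lemma compact_esphere : compact [set x : 'rV[R]_n | dotv x x = 1].
Proof.
apply: (@subclosed_compact _ _ [set x : 'rV[R]_n | dotv x x <= 1]).
- exact: ((continuous_closedP _).1 continuous_dotv _ (@closed_eq _ 1)).
- exact: compact_eball.
- by move=> x /= ->.
Qed.

Lemma coercive_max (f : 'rV[R]_n -> R) (r : R) : continuous f ->
  (forall x, r < enorm x -> f x <= f 0) -> exists p, forall x, f x <= f p.
Proof.
move=> cf fr.
(* The radius enters squared, so [0] lies in the ball even if [r] is negative. *)
have z0 : [set x : 'rV[R]_n | dotv x x <= r ^+ 2] 0.
  by rewrite /= /dotv big1 ?sqr_ge0 // => i _; rewrite mxE mulr0.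
have [||p pB pmax] := EVT_max_rV (f := f) _ (@compact_eball (r ^+ 2)).
- by exists 0.
- exact: continuous_subspaceT.
have f0p : f 0 <= f p by apply: pmax; rewrite inE.
exists p => x; have [rx|xr] := ltP r (enorm x).
  exact: le_trans (fr x rx) f0p.
apply: pmax; rewrite inE /= -enorm_sqr ler_pXn2r ?nnegrE ?enorm_ge0 //.
exact: le_trans (enorm_ge0 x) xr.
Qed.

End EuclideanNorm.

(** * Space-like graphs *)

Section SpacelikeGraph.
Context {R : realType} {n m : nat} (u : 'rV[R]_n -> 'rV[R]_m).
Context (u_smooth : smooth u).
Context (g_posdef : forall x : 'rV[R]_n, posdefmx (graph_metric u x)).
Context (u0 : forall a : 'I_m, component u a 0 = 0).
Local Notation U := (component u).

Lemma differentiable_U a x : differentiable (U a) x.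
Proof. exact: Ck_derivable (u_smooth a 1) x. Qed.

Lemma differentiable_DU a v x : differentiable ('D_v (U a)) x.
Proof. exact: Ck_derivable (Ck_derive v (u_smooth a 2)) x. Qed.

Lemma differentiable_DDU a v w x : differentiable ('D_w ('D_v (U a))) x.
Proof. exact: Ck_derivable (Ck_derive w (Ck_derive v (u_smooth a 3))) x. Qed.

Lemma is_derive_U a v x : is_derive x v (U a) ('D_v (U a) x).
Proof. by apply: derivableP; apply: diff_derivable; apply: differentiable_U. Qed.

Lemma is_derive_DU a v w x : is_derive x w ('D_v (U a)) ('D_w ('D_v (U a)) x).
Proof. by apply: derivableP; apply: diff_derivable; apply: differentiable_DU. Qed.

Lemma is_derive_DDU a v w t x :
  is_derive x t ('D_w ('D_v (U a))) ('D_t ('D_w ('D_v (U a))) x).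
Proof. by apply: derivableP; apply: diff_derivable; apply: differentiable_DDU. Qed.

Lemma deriveUE a v x : 'D_v (U a) x = \sum_i v 0 i * partial i (U a) x.
Proof. exact: (congr1 (fun f => f x) (Ck_deriveE (u_smooth a 1) v)). Qed.

Lemma metric_form x (v w : 'rV[R]_n) :
  (v *m graph_metric u x *m w^T) 0 0 =
  dotv v w - \sum_a 'D_v (U a) x * 'D_w (U a) x.
Proof.
pose J : 'M[R]_(n, m) := \matrix_(i, a) partial i (U a) x.
have -> : graph_metric u x = 1%:M - J *m J^T.
  apply/matrixP => i j; rewrite !mxE; congr (_ - _).
  by apply: eq_bigr => a _; rewrite !mxE.
rewrite mulmxBr mulmxBl mulmx1 mulmxA -mulmxA -trmx_mul mxE [X in _ + X]mxE.
rewrite -dotv_mulmx -dotv_mulmx; congr (_ - _); apply: eq_bigr => a _.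
by rewrite !deriveUE !mxE; congr (_ * _); apply: eq_bigr => i _; rewrite mxE.
Qed.

Lemma spacelike_derive x v : v != 0 -> \sum_a 'D_v (U a) x ^+ 2 < dotv v v.
Proof. by move=> v0; have [_ /(_ v v0)] := g_posdef x; rewrite metric_form subr_gt0. Qed.

(** The mean value theorem has no equality form for vector-valued maps, so it is applied to [u]
    paired with the fixed vector [k = u x - u y]. By Cauchy-Schwarz one factor [dotv k k] cancels,
    unless [k = 0], and the space-like condition bounds what is left. *)
Lemma graph_contraction x y : x != y ->
  dotv (u x - u y) (u x - u y) < dotv (x - y) (x - y).
Proof.
move=> xy; set w := x - y; set k := u x - u y.
have w0 : w != 0 by rewrite subr_eq0.
pose f p := \sum_a k 0 a * U a p.
have df p : is_derive p w f (\sum_a k 0 a * 'D_w (U a) p).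
  by apply: is_derive_bigsum => a; apply: is_derive_cmul; apply: is_derive_U.
have [t [_]] := MVT_dir y 1 (fun p => @ex_derive _ _ _ _ _ _ _ (df p)).
rewrite scale1r mul1r subrKC (@derive_val _ _ _ _ _ _ _ (df _)).
set p := y + _ => E.
have {}E : dotv k k = \sum_a k 0 a * 'D_w (U a) p.
  rewrite -E /f -sumrB; apply: eq_bigr => a _.
  by rewrite -mulrBr; congr (_ * _); rewrite /k !mxE.
have := cauchy_schwarz_sum (index_enum 'I_m) (k 0) (fun a => 'D_w (U a) p).
rewrite -E -/(dotv k k) expr2.
have := spacelike_derive p w0.
have := dotv_ge0 k; rewrite le_eqVlt => /orP[/eqP <- H _|k0 H].
  by rewrite lt_def dotv_ge0 dotv_eq0 w0.
by rewrite ler_pM2l // => H2; apply: le_lt_trans H2 H.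
Qed.

Lemma u_at0 : u 0 = 0.
Proof. by apply/rowP => a; have := u0 a; rewrite /component mxE. Qed.

(** The pseudo-Euclidean square of the position vector [(x, u x)] of the graph. *)
Definition lorentz_sq x := dotv x x - dotv (u x) (u x).

Lemma lorentz_sq_ge0 x : 0 <= lorentz_sq x.
Proof.
have [->|x0] := eqVneq x 0; first by rewrite /lorentz_sq u_at0 !dotv00 subrr.
by have := graph_contraction x0; rewrite u_at0 !subr0 subr_ge0 => /ltW.
Qed.

Lemma differentiable_lorentz_sq x : differentiable lorentz_sq x.
Proof.
apply: differentiableB; apply: differentiable_dotv => i.
- exact: differentiable_coord.
- exact: differentiable_coord.
- exact: differentiable_U.
- exact: differentiable_U.
Qed.

(* [|x| - |u x|] is nondecreasing along rays, hence bounded below by its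
   minimum over the unit sphere. *)
Lemma lorentz_sq_growth :
  exists2 c : R, 0 < c & forall x, 1 <= enorm x -> c * enorm x <= lorentz_sq x.
Proof.
suff [c c0 H] : exists2 c : R, 0 < c &
    forall x, 1 <= enorm x -> enorm (u x) <= enorm x - c.
  exists c => // x x1; have {}H := H x x1.
  have ux := enorm_ge0 (u x).
  (* The difference of squares factors: [|x| - |u x|] is at least [c] and [|x| + |u x|] at least
     [|x|]. *)
  rewrite /lorentz_sq -!enorm_sqr.
  by nra.
pose S := [set x : 'rV[R]_n | dotv x x = 1].
have nx x : 1 <= enorm x -> S ((enorm x)^-1 *: x).
  move=> x1; have x0 : enorm x != 0 by rewrite gt_eqF // (lt_le_trans ltr01).
  by rewrite /S /= dotvZl dotvZr -enorm_sqr; field.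
(* The sphere is empty only for [n = 0], where no point has norm at least 1. *)
have [S0|S0] := pselect (S !=set0); last first.
  by exists 1 => // x /nx Sx; exfalso; apply: S0; exists ((enorm x)^-1 *: x).
have cu : continuous (fun x => dotv (u x) (u x)).
  move=> x; apply: differentiable_continuous.
  by apply: differentiable_dotv => i; apply: differentiable_U.
have [|q qS qmax] := EVT_max_rV (f := fun x => dotv (u x) (u x)) S0 compact_esphere.
  exact: continuous_subspaceT.
have q1 : enorm (u q) < 1.
  rewrite inE in qS.
  have q0 : q != 0 by rewrite -dotv_eq0 qS oner_eq0.
  have := graph_contraction q0; rewrite u_at0 !subr0 qS => H.
  by rewrite -sqrtr1 /enorm ltr_sqrt.
exists (1 - enorm (u q)); first by rewrite subr_gt0.
move=> x x1; set y := (enorm x)^-1 *: x.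
have xp : 0 < enorm x := lt_le_trans ltr01 x1.
have uy : enorm (u y) <= enorm (u q).
  by apply: ler_wsqrtr; apply: qmax; rewrite inE; exact: nx.
have xy : enorm (x - y) = enorm x - 1.
  have -> : x - y = (1 - (enorm x)^-1) *: x by rewrite scalerBl scale1r.
  rewrite enormZ ger0_norm; last by rewrite subr_ge0 invf_le1.
  by rewrite mulrBl mul1r mulVf // gt_eqF.
have uxy : enorm (u x - u y) <= enorm (x - y).
  have [->|xney] := eqVneq x y; first by rewrite !subrr /enorm !dotv00.
  by apply: ler_wsqrtr; apply: ltW; exact: graph_contraction.
have := enormD (u y) (u x - u y); rewrite subrKC.
by lra.
Qed.

End SpacelikeGraph.

(** * The drift Laplacian *)

Opaque derive.

(** Both derivatives are along the same [v]: in an orthonormal frame the drift Laplacian contains no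
    mixed second derivatives. *)
Definition twice_derivable (R : realType) (n : nat) (f : 'rV[R]_n -> R) : Prop :=
  (forall x v, derivable f x v) /\ (forall x v, derivable ('D_v f) x v).

(* In a frame of the graph orthonormal at p, the drift Laplacian
   [g^ij f_ij - x . Df] at p. *)
Definition drift_laplacian (R : realType) (n : nat) (P : 'M[R]_n)
    (f : 'rV[R]_n -> R) (p : 'rV[R]_n) : R :=
  \sum_c 'D_(row c P) ('D_(row c P) f) p - 'D_p f p.

Section DriftLaplacian.
Context {R : realType} {n : nat}.
Implicit Types (f g : 'rV[R]_n -> R) (p x v w : 'rV[R]_n) (P : 'M[R]_n).

Lemma derive_axpy (c : R) f g v : (forall x, derivable f x v) ->
  (forall x, derivable g x v) ->
  'D_v (fun x => c * f x + g x) = (fun x => c * 'D_v f x + 'D_v g x).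
Proof.
move=> df dg; apply/funext => x.
by case: (is_derive_add (is_derive_cmul c (derivableP (df x))) (derivableP (dg x))).
Qed.

Lemma derivable_axpy (c : R) f g x v : derivable f x v -> derivable g x v ->
  derivable (fun x => c * f x + g x) x v.
Proof.
move=> df dg.
by case: (is_derive_add (is_derive_cmul c (derivableP df)) (derivableP dg)).
Qed.

Lemma twice_derivable_axpy (c : R) f g : twice_derivable f ->
  twice_derivable g -> twice_derivable (fun x => c * f x + g x).
Proof.
move=> [df ddf] [dg ddg]; split=> x v; first exact: derivable_axpy.
by rewrite derive_axpy //; apply: derivable_axpy.
Qed.

Lemma drift_laplacian_axpy P (c : R) f g p : twice_derivable f ->
  twice_derivable g ->
  drift_laplacian P (fun x => c * f x + g x) p =
  c * drift_laplacian P f p + drift_laplacian P g p.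
Proof.
move=> [df ddf] [dg ddg].
have E1 : \sum_i 'D_(row i P) ('D_(row i P) (fun x => c * f x + g x)) p =
    c * (\sum_i 'D_(row i P) ('D_(row i P) f) p) +
    \sum_i 'D_(row i P) ('D_(row i P) g) p.
  rewrite mulr_sumr -big_split; apply: eq_bigr => i _ /=.
  have H1 := derive_axpy c (fun x => df x (row i P)) (fun x => dg x (row i P)).
  have H2 := derive_axpy c (fun x => ddf x (row i P)) (fun x => ddg x (row i P)).
  exact: (etrans (congr1 (fun h => 'D_(row i P) h p) H1) (congr1 (fun h => h p) H2)).
have E2 := congr1 (fun h => h p) (derive_axpy c (fun x => df x p) (fun x => dg x p)).
have E (a b a' b' : R) : c * a + b - (c * a' + b') = c * (a - a') + (b - b').
  by ring.
exact: (etrans (congr2 (fun a b => a - b) E1 E2) (E _ _ _ _)).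
Qed.

Lemma drift_laplacian_max P f p : twice_derivable f ->
  (forall x, f x <= f p) -> drift_laplacian P f p <= 0.
Proof.
move=> [df ddf] fmax; rewrite /drift_laplacian.
have H v := second_derivative_test (fun y => df y v) fmax (derivableP (ddf p v)).
rewrite (proj1 (H p)) subr0; apply: sumr_le0 => c _.
exact: (proj2 (H _)).
Qed.

(** By symmetry in the first two indices both halves of the mixed sum equal [X], and since
    [(a + b)^2 - 4 a b = (a - b)^2] the whole is the sum of the squares of [S i j k - S i k j]. This
    absorbs the terms of [L phi] that have no sign by themselves. *)
Lemma triple_sum_ge0 (S : 'I_n -> 'I_n -> 'I_n -> R) :
  (forall i j k, S i j k = S j i k) ->
  0 <= \sum_i \sum_j \sum_k (S i j k + S i k j) ^+ 2
     - 2 * \sum_i \sum_j \sum_k (S i j k + S i k j) * S k j i.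
Proof.
move=> Ssym.
set X := \sum_i \sum_j \sum_k S i j k * S i k j.
have -> : \sum_i \sum_j \sum_k (S i j k + S i k j) * S k j i = X + X.
  transitivity (\sum_i \sum_j \sum_k S i j k * S k j i +
                \sum_i \sum_j \sum_k S i k j * S k j i).
    rewrite -big_split; apply: eq_bigr => i _; rewrite -big_split.
    apply: eq_bigr => j _; rewrite -big_split; apply: eq_bigr => k _ /=.
    by rewrite mulrDl.
  congr (_ + _).
    rewrite exchange_big; apply: eq_bigr => i _; apply: eq_bigr => j _.
    by apply: eq_bigr => k _; rewrite (Ssym j i) (Ssym k i).
  rewrite /X [RHS]exchange_big; apply: eq_bigr => i _; rewrite [RHS]exchange_big.
  by apply: eq_bigr => j _; apply: eq_bigr => k _; rewrite (Ssym i k).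
have -> : \sum_i \sum_j \sum_k (S i j k + S i k j) ^+ 2 - 2 * (X + X) =
    \sum_i \sum_j \sum_k (S i j k - S i k j) ^+ 2.
  apply/eqP; rewrite subr_eq; apply/eqP.
  have -> : 2 * (X + X) = \sum_i \sum_j \sum_k 4 * (S i j k * S i k j).
    transitivity (4 * X); first by ring.
    rewrite /X mulr_sumr; apply: eq_bigr => i _; rewrite mulr_sumr.
    by apply: eq_bigr => j _; rewrite mulr_sumr.
  rewrite -big_split; apply: eq_bigr => i _; rewrite -big_split.
  apply: eq_bigr => j _; rewrite -big_split; apply: eq_bigr => k _ /=.
  by ring.
do 3 (apply: sumr_ge0 => ? _); exact: sqr_ge0.
Qed.

(** * Gaussian functions as barriers *)

Section Gaussian.
Context (q : 'rV[R]_n) (al : R).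

Definition gaussian x := expR (- (al * dotv (x - q) (x - q))).

Lemma gaussian_gt0 x : 0 < gaussian x.
Proof. exact: expR_gt0. Qed.

Lemma gaussian_le1 x : 0 <= al -> gaussian x <= 1.
Proof. by move=> al0; rewrite -expR0 ler_expR oppr_le0 mulr_ge0 ?dotv_ge0. Qed.

Lemma gaussian_ge x (rho : R) : 0 <= al -> dotv (x - q) (x - q) <= rho ->
  expR (- (al * rho)) <= gaussian x.
Proof. by move=> al0 H; rewrite ler_expR lerN2 ler_wpM2l. Qed.

Lemma gaussian_decay x y : 0 <= al ->
  dotv (y - q) (y - q) + 1 <= dotv (x - q) (x - q) ->
  gaussian x <= expR (- al) * gaussian y.
Proof.
move=> al0 H; rewrite /gaussian -expRD ler_expR -opprD lerN2.
by rewrite -{1}[al]mulr1 -mulrDr ler_wpM2l // addrC.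
Qed.

Lemma is_derive_dotv_sub x v :
  is_derive x v (fun y => dotv (y - q) (y - q)) (2 * dotv (x - q) v).
Proof.
have H i : is_derive x v (fun y : 'rV[R]_n => (y - q) 0 i) (v 0 i).
  rewrite (_ : (fun y : 'rV[R]_n => (y - q) 0 i) = (fun y => y 0 i - q 0 i)); last first.
    by apply/funext => y; rewrite !mxE.
  have := is_derive_sub (is_derive_coord x v i) (is_derive_const (q 0 i) x v).
  by rewrite subr0.
have := is_derive_bigsum (index_enum 'I_n) (fun i => is_derive_mul (H i) (H i)).
congr is_derive; rewrite /dotv mulr_sumr; apply: eq_bigr => i _; ring.
Qed.

Lemma is_derive_dotv_sub_r x v w :
  is_derive x v (fun y => dotv (y - q) w) (dotv v w).
Proof.
apply: is_derive_bigsum => i.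
rewrite (_ : (fun y : 'rV[R]_n => (y - q) 0 i * w 0 i) =
  (fun y => w 0 i * (y 0 i - q 0 i))); last first.
  by apply/funext => y; rewrite !mxE mulrC.
have := is_derive_cmul (w 0 i) (is_derive_sub (is_derive_coord x v i)
          (is_derive_const (q 0 i) x v)).
by rewrite subr0 mulrC.
Qed.

Lemma continuous_gaussian : continuous gaussian.
Proof.
move=> x; apply: differentiable_continuous.
apply: (@differentiable_comp _ _ _ _ (fun y => - (al * dotv (y - q) (y - q))) expR).
  apply: differentiableN; apply: differentiableM; first exact: differentiable_cst.
  apply: differentiable_dotv => i;
    by under eq_fun do rewrite mxE; apply: differentiableD;
      [exact: differentiable_coord|exact: differentiable_cst].
by apply/derivable1_diffP; exact: derivable_expR.
Qed.

Lemma is_derive_gaussian x v :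
  is_derive x v gaussian (- (2 * al) * dotv (x - q) v * gaussian x).
Proof.
have := is_derive_comp1 (is_derive_opp (is_derive_cmul al (is_derive_dotv_sub x v)))
  (is_derive_expR _).
by congr is_derive; rewrite /gaussian; ring.
Qed.

Lemma derive_gaussian v :
  'D_v gaussian = (fun x => - (2 * al) * dotv (x - q) v * gaussian x).
Proof. by apply/funext => x; case: (is_derive_gaussian x v). Qed.

Lemma is_derive2_gaussian x v w : is_derive x w ('D_v gaussian)
  ((4 * al ^+ 2 * dotv (x - q) v * dotv (x - q) w - 2 * al * dotv w v) * gaussian x).
Proof.
rewrite derive_gaussian.
have := is_derive_mul (is_derive_cmul (- (2 * al)) (is_derive_dotv_sub_r x w v))
  (is_derive_gaussian x w).
by congr is_derive; ring.
Qed.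

Lemma twice_derivable_gaussian : twice_derivable gaussian.
Proof.
split=> x v; first by case: (is_derive_gaussian x v).
by case: (is_derive2_gaussian x v v).
Qed.

(** In an orthonormal frame the first sum is at least [|p - q|^2] and the second is the trace of the
    inverse metric. On a bounded set the bracket is therefore positive away from [q] once [al] is
    large. *)
Lemma drift_laplacian_gaussian P p : drift_laplacian P gaussian p =
  2 * al * gaussian p * (2 * al * (\sum_c dotv (p - q) (row c P) ^+ 2) -
    \sum_c dotv (row c P) (row c P) + dotv (p - q) p).
Proof.
rewrite /drift_laplacian (derive_val (is_derive := is_derive_gaussian p p)).
rewrite (eq_bigr (fun c => (4 * al ^+ 2 * gaussian p) * dotv (p - q) (row c P) ^+ 2 +
   (- (2 * al * gaussian p)) * dotv (row c P) (row c P))); last first.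
  move=> c _; have [_ ->] := is_derive2_gaussian p (row c P) (row c P).
  by ring.
by rewrite big_split /= -!mulr_sumr; ring.
Qed.

End Gaussian.
End DriftLaplacian.

(** * The drift Laplacian of log det g and of |x|^2 - |u|^2 *)

Lemma posdef_det_gt0 (R : realType) (n : nat) (A : 'M[R]_n) :
  posdefmx A -> 0 < \det A.
Proof.
move=> /posdef_frame[P /(congr1 determinant)].
rewrite !det_mulmx det_tr det1 mulrAC -expr2 => E.
have P2 : 0 < \det P ^+ 2.
  rewrite lt_def sqr_ge0 andbT; apply/eqP => E0; move: E => /eqP.
  by rewrite E0 mul0r eq_sym oner_eq0.
by rewrite -(pmulr_rgt0 _ P2) E ltr01.
Qed.

(* [h], [H], [T] are the first, second and third derivatives of u in a frame
   orthonormal for g at the point, [dA] the derivative of g in this frame, and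
   [G] that of [x . Du]; the last hypothesis is the derivative of the equation.
   [S i j k] below is [u_ij . u_k]. *)
Lemma frame_algebra (R : realType) (n m : nat) (h G : 'I_n -> 'I_m -> R)
    (H T : 'I_m -> 'I_n -> 'I_n -> R) (dA : 'I_n -> 'I_n -> 'I_n -> R) :
  (forall a i j, H a i j = H a j i) ->
  (forall c i j, dA c i j = - \sum_a (H a c i * h j a + h i a * H a c j)) ->
  (forall a i, \sum_c T a c i = G i a + \sum_b \sum_c dA i b c * H a c b) ->
  2 * \sum_a \sum_b \sum_c H a c b ^+ 2 <=
  \sum_c (\sum_i \sum_j dA c i j * dA c j i -
          \sum_i - \sum_a (T a c i * h i a + H a c i * H a c i +
                           (H a c i * H a c i + h i a * T a c i))) -
  - \sum_i - \sum_a (G i a * h i a + h i a * G i a).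
Proof.
move=> Hsym dAE TE.
pose S c b i := \sum_a H a c b * h i a.
have Ssym i j k : S i j k = S j i k by apply: eq_bigr => a _; rewrite Hsym.
have dAS c i j : dA c i j = - (S c i j + S c j i).
  rewrite dAE big_split; congr (- (_ + _)).
  by apply: eq_bigr => a _; exact: mulrC.
have E1 : \sum_c \sum_i \sum_j dA c i j * dA c j i =
    \sum_c \sum_i \sum_j (S c i j + S c j i) ^+ 2.
  apply: eq_bigr => c _; apply: eq_bigr => i _; apply: eq_bigr => j _.
  by rewrite !dAS; ring.
(* The differentiated equation, contracted with [h]: it trades the third derivatives for the drift
   term and products of [dA] with [S]. *)
have E2 : \sum_i \sum_a G i a * h i a + \sum_i \sum_j \sum_k dA i j k * S k j i =
    \sum_i \sum_a (\sum_c T a c i) * h i a.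
  rewrite -big_split; apply: eq_bigr => i _ /=.
  rewrite [RHS](eq_bigr (fun a => G i a * h i a +
    \sum_j \sum_k dA i j k * (H a k j * h i a))); last first.
    move=> a _; rewrite TE mulrDl; congr (_ + _); rewrite mulr_suml.
    apply: eq_bigr => j _; rewrite mulr_suml; apply: eq_bigr => k _.
    by rewrite mulrA.
  rewrite [RHS]big_split; congr (_ + _); rewrite [RHS]exchange_big; apply: eq_bigr => j _.
  by rewrite [RHS]exchange_big; apply: eq_bigr => k _; rewrite /S mulr_sumr.
have E3 : \sum_i \sum_j \sum_k dA i j k * S k j i =
    - \sum_i \sum_j \sum_k (S i j k + S i k j) * S k j i.
  rewrite -sumrN; apply: eq_bigr => i _; rewrite -sumrN; apply: eq_bigr => j _.
  by rewrite -sumrN; apply: eq_bigr => k _; rewrite dAS mulNr.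
have E4 : \sum_c \sum_i - \sum_a (T a c i * h i a + H a c i * H a c i +
      (H a c i * H a c i + h i a * T a c i)) =
    - (2 * \sum_i \sum_a (\sum_c T a c i) * h i a) -
    2 * \sum_a \sum_b \sum_c H a c b ^+ 2.
  have -> : \sum_a \sum_b \sum_c H a c b ^+ 2 = \sum_c \sum_i \sum_a H a c i ^+ 2.
    rewrite exchange_big; under eq_bigr do rewrite exchange_big.
    by rewrite exchange_big.
  have -> : \sum_i \sum_a (\sum_c T a c i) * h i a =
      \sum_c \sum_i \sum_a T a c i * h i a.
    rewrite [RHS]exchange_big; apply: eq_bigr => i _; rewrite [RHS]exchange_big.
    by apply: eq_bigr => a _; rewrite mulr_suml.
  rewrite !mulr_sumr -sumrN -sumrB; apply: eq_bigr => c _.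
  rewrite !mulr_sumr -sumrN -sumrB; apply: eq_bigr => i _.
  rewrite !mulr_sumr -!sumrN -big_split; apply: eq_bigr => a _ /=.
  by ring.
have E5 : \sum_i - \sum_a (G i a * h i a + h i a * G i a) =
    - (2 * \sum_i \sum_a G i a * h i a).
  rewrite mulr_sumr -sumrN; apply: eq_bigr => i _; congr (- _).
  by rewrite mulr_sumr; apply: eq_bigr => a _; ring.
rewrite sumrB E1 E4 E5 -E2 E3.
have := triple_sum_ge0 Ssym.
by lra.
Qed.

Lemma sum_identity_mx (R : realType) (n : nat) (W : 'I_n -> 'I_n -> R) :
  \sum_b \sum_c (1%:M : 'M[R]_n) b c * W b c = \sum_b W b b.
Proof.
apply: eq_bigr => b _; rewrite (bigD1 b) //= big1 ?addr0 ?mxE ?eqxx ?mul1r //.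
by move=> c cb; rewrite mxE eq_sym (negbTE cb) mul0r.
Qed.

Section ShrinkerGraph.
Context {R : realType} {n m : nat} (u : 'rV[R]_n -> 'rV[R]_m).
Context (u_smooth : smooth u).
Context (g_posdef : forall x : 'rV[R]_n, posdefmx (graph_metric u x)).
Context (u_eq : forall (x : 'rV[R]_n) (a : 'I_m),
    \sum_(i < n) \sum_(j < n)
      invmx (graph_metric u x) i j * partial j (partial i (component u a)) x
    = - component u a x + dotv x (gradient (component u a) x)).
Local Notation U := (component u).

Definition neg_log_det x := - ln (\det (graph_metric u x)).

(** * The equation and its consequences in a frame orthonormal at one point *)

Section Frame.
Context (P : 'M[R]_n) (p : 'rV[R]_n).
Context (P_frame : P *m graph_metric u p *m P^T = 1%:M).
Local Notation w i := (row i P).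

(* The metric in the constant frame [w], which is orthonormal only at p. *)
Let A x := P *m graph_metric u x *m P^T.

Let AE x i j : A x i j =
  dotv (w i) (w j) - \sum_a 'D_(w i) (U a) x * 'D_(w j) (U a) x.
Proof.
rewrite -(metric_form u_smooth) /A -row_mul mxE [RHS]mxE.
apply: eq_bigr => k _; congr (_ * _); last by rewrite !mxE.
by rewrite [RHS]mxE.
Qed.

Let dA v x : 'M[R]_n := \matrix_(i, j)
  - \sum_a ('D_v ('D_(w i) (U a)) x * 'D_(w j) (U a) x +
            'D_(w i) (U a) x * 'D_v ('D_(w j) (U a)) x).

Let is_derive_A v x i j : is_derive x v (fun y => A y i j) (dA v x i j).
Proof.
rewrite mxE (_ : (fun y => A y i j) = fun y =>
  dotv (w i) (w j) - \sum_a 'D_(w i) (U a) y * 'D_(w j) (U a) y); last first.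
  by apply/funext => y; rewrite AE.
have H := is_derive_bigsum (index_enum 'I_m) (fun a =>
  is_derive_mul (is_derive_DU u_smooth a (w i) v x) (is_derive_DU u_smooth a (w j) v x)).
by have := is_derive_sub (is_derive_const (dotv (w i) (w j)) x v) H; rewrite sub0r.
Qed.

Let differentiable_A x i j : differentiable (fun y => A y i j) x.
Proof.
rewrite (_ : (fun y => A y i j) = fun y =>
  dotv (w i) (w j) - \sum_a 'D_(w i) (U a) y * 'D_(w j) (U a) y); last first.
  by apply/funext => y; rewrite AE.
apply: differentiableB; first exact: differentiable_cst.
apply: differentiable_bigsum => a.
by apply: differentiableM; apply: differentiable_DU.
Qed.

Let ddA v x : 'M[R]_n := \matrix_(i, j)
  - \sum_a ('D_v ('D_v ('D_(w i) (U a))) x * 'D_(w j) (U a) x +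
            'D_v ('D_(w i) (U a)) x * 'D_v ('D_(w j) (U a)) x +
            ('D_v ('D_(w i) (U a)) x * 'D_v ('D_(w j) (U a)) x +
            'D_(w i) (U a) x * 'D_v ('D_v ('D_(w j) (U a))) x)).

Let is_derive_dA v x i j : is_derive x v (fun y => dA v y i j) (ddA v x i j).
Proof.
rewrite mxE (_ : (fun y => dA v y i j) = fun y =>
  - \sum_a ('D_v ('D_(w i) (U a)) y * 'D_(w j) (U a) y +
            'D_(w i) (U a) y * 'D_v ('D_(w j) (U a)) y)); last first.
  by apply/funext => y; rewrite mxE.
apply: is_derive_opp; apply: is_derive_bigsum => a.
apply: is_derive_add; apply: is_derive_mul.
- exact: is_derive_DDU.
- exact: is_derive_DU.
- exact: is_derive_DU.
- exact: is_derive_DDU.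
Qed.

Let Ap : A p = 1%:M. Proof. exact: P_frame. Qed.

Let detA x : \det (A x) = \det P ^+ 2 * \det (graph_metric u x).
Proof. by rewrite !det_mulmx det_tr mulrAC -expr2. Qed.

Let detP2 : 0 < \det P ^+ 2.
Proof.
rewrite lt_def sqr_ge0 andbT; apply/eqP => E.
have := detA p; rewrite Ap det1 E mul0r => /eqP.
by rewrite oner_eq0.
Qed.

Let detA_gt0 x : 0 < \det (A x).
Proof. by rewrite detA mulr_gt0 // posdef_det_gt0. Qed.

Let A_unit x : A x \in unitmx.
Proof. by rewrite unitmxE unitfE gt_eqF. Qed.

(** The constant frame changes [log det g] only by an additive constant, so derivatives at [p] can
    be computed from [A], which is the identity there. *)
Let neg_log_detE : neg_log_det =
  fun x => (-1) * ln (\det (A x)) + ln (\det P ^+ 2).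
Proof.
apply/funext => x; rewrite /neg_log_det detA lnM ?posrE ?posdef_det_gt0 //.
by ring.
Qed.

Let is_derive_neg_log_det v x : is_derive x v neg_log_det
  (- \sum_i \sum_j dA v x i j * invmx (A x) j i).
Proof.
rewrite neg_log_detE.
have := is_derive_add (is_derive_cmul (-1)
  (is_derive_ln_det (detA_gt0 x) (is_derive_A v x)))
  (is_derive_const (ln (\det P ^+ 2)) x v).
by rewrite addr0 mulN1r.
Qed.

Let is_derive2_neg_log_det v : is_derive p v ('D_v neg_log_det)
  (\sum_i \sum_j dA v p i j * dA v p j i - \sum_i ddA v p i i).
Proof.
have -> : 'D_v neg_log_det = fun x => (-1) * 'D_v (fun y => ln (\det (A y))) x.
  apply/funext => x; case: (is_derive_neg_log_det v x) => _ ->.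
  by case: (is_derive_ln_det (detA_gt0 x) (is_derive_A v x)) => _ ->; rewrite mulN1r.
have := is_derive_cmul (-1) (is_derive2_ln_det1 detA_gt0 Ap
  (differentiable_A p) (is_derive_A v) (is_derive_dA v p)).
by rewrite mulN1r opprB.
Qed.

(** Needed at every [x], because it is differentiated next. With both contractions written as
    traces, the change of frame amounts to [P^T *m invmx (A x) *m P] being the inverse of
    [graph_metric u x]. *)
Let frame_eq x a :
  \sum_b \sum_c invmx (A x) b c * 'D_(w c) ('D_(w b) (U a)) x =
  - U a x + \sum_i x 0 i * partial i (U a) x.
Proof.
have -> : \sum_i x 0 i * partial i (U a) x = dotv x (gradient (U a) x).
  by apply: eq_bigr => i _; rewrite mxE.
rewrite -u_eq.
pose H : 'M[R]_n := \matrix_(i, j) partial j (partial i (U a)) x.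
have trE (B K : 'M[R]_n) : \sum_i \sum_j B i j * K i j = \tr (B *m K^T).
  by apply: eq_bigr => i _; rewrite mxE; apply: eq_bigr => j _; rewrite mxE.
have KE b c : 'D_(w c) ('D_(w b) (U a)) x = (P *m H *m P^T) b c.
  have E1 : 'D_(w b) (U a) = fun y => \sum_i P b i * partial i (U a) y.
    rewrite (Ck_deriveE (u_smooth a 1)); apply/funext => y.
    by apply: eq_bigr => i _; rewrite mxE.
  rewrite E1.
  have Hp i : Ck 1 (partial i (U a)) by case: (CkP (u_smooth a 2)).
  have := is_derive_bigsum (index_enum 'I_n) (fun i => is_derive_cmul (P b i)
    (derivableP (@diff_derivable _ _ _ _ _ (w c) (Ck_derivable (Hp i) x)))).
  case=> _ ->.
  have -> : (P *m H *m P^T) b c = \sum_j \sum_i P b i * H i j * P c j.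
    rewrite mxE; apply: eq_bigr => j _; rewrite mxE mulr_suml.
    by apply: eq_bigr => i _; rewrite [P^T _ _]mxE.
  rewrite exchange_big; apply: eq_bigr => i _.
  rewrite (congr1 (fun f => f x) (Ck_deriveE (Hp i) (w c))) mulr_sumr.
  apply: eq_bigr => j _; rewrite !mxE -mulrA; congr (_ * _); exact: mulrC.
apply: (@etrans _ _ (\tr (invmx (A x) *m (P *m H *m P^T)^T))).
  rewrite -trE; apply: eq_bigr => b _; apply: eq_bigr => c _.
  congr (_ * _); exact: KE.
apply: (@etrans _ _ (\tr (invmx (graph_metric u x) *m H^T))); last first.
  rewrite -trE; apply: eq_bigr => i _; apply: eq_bigr => j _.
  congr (_ * _); exact: mxE.
rewrite !trmx_mul trmxK !mulmxA [LHS]mxtrace_mulC !mulmxA.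
congr (mxtrace _); congr (_ *m _).
have Pu : P \in unitmx by rewrite unitmxE unitfE -sqrf_eq0 gt_eqF.
have gu : graph_metric u x \in unitmx by rewrite unitmxE unitfE gt_eqF // posdef_det_gt0.
have E : P *m (graph_metric u x *m (P^T *m invmx (A x) *m P)) = P.
  by rewrite !mulmxA -/(A x) (mulmxV (A_unit x)) mul1mx.
have E2 : graph_metric u x *m (P^T *m invmx (A x) *m P) = 1%:M.
  by rewrite -[LHS](mulKmx Pu) E mulVmx.
by rewrite -[LHS](mulKmx gu) E2 mulmx1.
Qed.

(** The derivative of [x . Du] along [v] contains an extra ['D_v u], which cancels against the
    derivative of [- u]. The [dA] term comes from the inverse metric, and commuting derivatives
    moves [v] innermost. *)
Let frame_eq_derive v a :
  \sum_c 'D_(w c) ('D_(w c) ('D_v (U a))) p =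
  'D_p ('D_v (U a)) p + \sum_b \sum_c dA v p b c * 'D_(w c) ('D_(w b) (U a)) p.
Proof.
have dL := is_derive_bigsum (index_enum 'I_n) (fun b =>
  is_derive_bigsum (index_enum 'I_n) (fun c => is_derive_mul
   (is_derive_invmx1 b c A_unit Ap (differentiable_A p) (is_derive_A v p))
   (is_derive_DDU u_smooth a (w b) (w c) v p))).
have dR := is_derive_add (is_derive_opp (is_derive_U u_smooth a v p))
  (is_derive_bigsum (index_enum 'I_n) (fun i => is_derive_mul
    (is_derive_coord p v i) (is_derive_DU u_smooth a (delta_mx 0 i) v p))).
rewrite -(funext (fun x => frame_eq x a)) in dR.
have [_ EL] := dL; have [_ ER] := dR.
have E := etrans (esym EL) ER.
have Dp : \sum_i p 0 i * 'D_v (partial i (U a)) p = 'D_p ('D_v (U a)) p.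
  rewrite -(congr1 (fun f => f p) (deriveC v p (u_smooth a 2))).
  rewrite (Ck_deriveE (u_smooth a 1)).
  have := is_derive_bigsum (index_enum 'I_n) (fun i => is_derive_cmul (p 0 i)
    (is_derive_DU u_smooth a (delta_mx 0 i) v p)).
  by case=> _ ->.
have Esum : \sum_i (v 0 i * partial i (U a) p + p 0 i * 'D_v (partial i (U a)) p) =
    'D_v (U a) p + 'D_p ('D_v (U a)) p.
  apply: etrans (big_split _ _ _ _ _) _; congr (_ + _); last exact: Dp.
  exact: (esym (deriveUE u_smooth a v p)).
have {}E := etrans E (congr1 (fun t => - 'D_v (U a) p + t) Esum).
rewrite addKr in E.
rewrite Ap invmx1 in E.
pose K b c := 'D_(w c) ('D_(w b) (U a)) p.
pose W b c := 'D_v ('D_(w c) ('D_(w b) (U a))) p.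
have EW : \sum_b \sum_c (- dA v p b c * K b c + (1%:M : 'M[R]_n) b c * W b c) =
    \sum_b W b b - \sum_b \sum_c dA v p b c * K b c.
  rewrite -sum_identity_mx -sumrB; apply: eq_bigr => b _; rewrite -sumrB.
  by apply: eq_bigr => c _; rewrite mulNr addrC.
have E7 := canRL (subrK _) (etrans (esym EW) E).
apply: etrans E7; apply: eq_bigr => c _.
have E1 : 'D_v ('D_(w c) ('D_(w c) (U a))) p = 'D_(w c) ('D_v ('D_(w c) (U a))) p.
  exact: (congr1 (fun f => f p) (deriveC v (w c) (Ck_derive (w c) (u_smooth a 3)))).
have E2 : 'D_v ('D_(w c) (U a)) = 'D_(w c) ('D_v (U a)).
  exact: (deriveC v (w c) (u_smooth a 2)).
exact: (esym (etrans E1 (congr1 (fun f => 'D_(w c) f p) E2))).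
Qed.

Lemma drift_laplacian_neg_log_det :
  2 * \sum_a \sum_b \sum_c ('D_(w c) ('D_(w b) (U a)) p) ^+ 2 <=
  drift_laplacian P neg_log_det p.
Proof.
pose h i a := 'D_(w i) (U a) p.
pose H a c b := 'D_(w c) ('D_(w b) (U a)) p.
pose T a c i := 'D_(w c) ('D_(w c) ('D_(w i) (U a))) p.
pose G i a := 'D_p ('D_(w i) (U a)) p.
have Hsym a i j : H a i j = H a j i.
  exact: (congr1 (fun f => f p) (deriveC (w i) (w j) (u_smooth a 2))).
have dAE c i j : dA (w c) p i j = - \sum_a (H a c i * h j a + h i a * H a c j).
  exact: mxE.
have TE a i : \sum_c T a c i = G i a + \sum_b \sum_c dA (w i) p b c * H a c b.
  exact: frame_eq_derive.
apply: le_trans (frame_algebra Hsym dAE TE) _.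
rewrite le_eqVlt; apply/orP; left; apply/eqP; rewrite /drift_laplacian.
congr (_ - _).
  apply: eq_bigr => c _; case: (is_derive2_neg_log_det (w c)) => _ ->.
  congr (_ - _); apply: eq_bigr => i _; apply: esym. exact: mxE.
case: (is_derive_neg_log_det p p) => _ ->; congr (- _).
apply: eq_bigr => i _; rewrite Ap invmx1.
apply: (@etrans _ _ ((dA p p *m 1%:M) i i)); last exact: mxE.
by rewrite mulmx1; apply: esym; exact: mxE.
Qed.

Lemma derivable_neg_log_det x v : derivable neg_log_det x v.
Proof. by case: (is_derive_neg_log_det v x). Qed.

Lemma derivable2_neg_log_det v : derivable ('D_v neg_log_det) p v.
Proof. by case: (is_derive2_neg_log_det v). Qed.

Let is_derive_lorentz_sq x v : is_derive x v (lorentz_sq u)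
  (2 * dotv x v - 2 * \sum_a U a x * 'D_v (U a) x).
Proof.
have dx := is_derive_bigsum (index_enum 'I_n) (fun i =>
  is_derive_mul (is_derive_coord x v i) (is_derive_coord x v i)).
have du := is_derive_bigsum (index_enum 'I_m) (fun a =>
  is_derive_mul (is_derive_U u_smooth a v x) (is_derive_U u_smooth a v x)).
have := is_derive_sub dx du; congr is_derive; congr (_ - _).
  by rewrite /dotv mulr_sumr; apply: eq_bigr => i _; ring.
rewrite mulr_sumr; apply: eq_bigr => a _.
by move: ('D_v (U a) x) (U a x) => c d; ring.
Qed.

Let derive_lorentz_sq v : 'D_v (lorentz_sq u) =
  fun x => 2 * dotv x v - 2 * \sum_a U a x * 'D_v (U a) x.
Proof. by apply/funext => x; case: (is_derive_lorentz_sq x v). Qed.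

Let is_derive2_lorentz_sq x v : is_derive x v ('D_v (lorentz_sq u))
  (2 * dotv v v - 2 * \sum_a ('D_v (U a) x * 'D_v (U a) x +
                               U a x * 'D_v ('D_v (U a)) x)).
Proof.
rewrite derive_lorentz_sq.
apply: is_derive_sub; apply: is_derive_cmul; apply: is_derive_bigsum => i.
  have := is_derive_cmul (v 0 i) (is_derive_coord x v i).
  by congr is_derive; apply/funext => y; exact: mulrC.
apply: is_derive_mul; [exact: is_derive_U|exact: is_derive_DU].
Qed.

Lemma twice_derivable_lorentz_sq : twice_derivable (lorentz_sq u).
Proof.
split=> x v; first by case: (is_derive_lorentz_sq x v).
by case: (is_derive2_lorentz_sq x v).
Qed.

(** The terms quadratic in first derivatives sum to the trace of the metric in its orthonormal
    frame, which is [n]; the others are given by the equation paired with [u], and its drift part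
    cancels. *)
Lemma drift_laplacian_lorentz_sq :
  drift_laplacian P (lorentz_sq u) p = 2 * n%:R - 2 * lorentz_sq u p.
Proof.
rewrite /drift_laplacian; have [_ ->] := is_derive_lorentz_sq p p.
have Lu a : \sum_c 'D_(w c) ('D_(w c) (U a)) p = - U a p + 'D_p (U a) p.
  have := frame_eq p a; rewrite Ap invmx1 => E.
  apply: etrans (esym (sum_identity_mx (fun b c => 'D_(w c) ('D_(w b) (U a)) p))) _.
  apply: (etrans E); congr (_ + _); exact: (esym (deriveUE u_smooth a p p)).
have diagA c : dotv (w c) (w c) - \sum_a 'D_(w c) (U a) p * 'D_(w c) (U a) p = 1.
  by rewrite -AE Ap mxE eqxx.
have -> : \sum_c 'D_(w c) ('D_(w c) (lorentz_sq u)) p =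
    2 * n%:R - 2 * \sum_a U a p * (- U a p + 'D_p (U a) p).
  have -> : (n%:R : R) = \sum_(c < n) 1 by rewrite sumr_const card_ord.
  have -> : \sum_a U a p * (- U a p + 'D_p (U a) p) =
      \sum_c \sum_a U a p * 'D_(w c) ('D_(w c) (U a)) p.
    rewrite exchange_big; apply: eq_bigr => a _; rewrite -mulr_sumr.
    by congr (_ * _); apply: esym; exact: Lu.
  rewrite !mulr_sumr -sumrB; apply: eq_bigr => c _.
  have [_ ->] := is_derive2_lorentz_sq p (w c).
  by rewrite -(diagA c) big_split /=; ring.
have -> : \sum_a U a p * (- U a p + 'D_p (U a) p) =
    - dotv (u p) (u p) + \sum_a U a p * 'D_p (U a) p.
  rewrite /dotv -sumrN -big_split; apply: eq_bigr => a _ /=.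
  by rewrite mulrDr mulrN.
rewrite /lorentz_sq.
by move: (\sum_a _) (dotv p p) (dotv (u p) (u p)) => c d e; ring.
Qed.

Let PtP : P^T *m P *m graph_metric u p = 1%:M.
Proof. by rewrite -mulmxA; apply: mulmx1C. Qed.

Let gPtP : graph_metric u p *m (P^T *m P) = 1%:M.
Proof. exact: mulmx1C PtP. Qed.

Let metric_le (v : 'rV[R]_n) : (v *m graph_metric u p *m v^T) 0 0 <= dotv v v.
Proof.
rewrite (metric_form u_smooth) gerBl; apply: sumr_ge0 => a _.
by rewrite -expr2 sqr_ge0.
Qed.

Let metric_ge0 (v : 'rV[R]_n) : 0 <= (v *m graph_metric u p *m v^T) 0 0.
Proof.
have [->|v0] := eqVneq v 0; first by rewrite mul0mx mul0mx mxE.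
by apply: ltW; have [_] := g_posdef p; apply.
Qed.

Let frame_dotvE (v : 'rV[R]_n) : \sum_c dotv v (w c) ^+ 2 = (v *m (P^T *m P) *m v^T) 0 0.
Proof.
have -> : v *m (P^T *m P) *m v^T = (v *m P^T) *m (v *m P^T)^T.
  by rewrite trmx_mul trmxK !mulmxA.
rewrite mxE; apply: eq_bigr => c _; rewrite [(_)^T _ _]mxE -expr2; congr (_ ^+ 2).
by rewrite mxE; apply: eq_bigr => i _; rewrite !mxE.
Qed.

(** The right side is the inverse metric [h = P^T *m P]. It dominates the Euclidean metric since [g]
    is dominated by it: expand [0 <= g(v - v h, v - v h) = g(v, v) - 2 |v|^2 + h(v, v)] and use
    [g(v, v) <= |v|^2]. *)
Lemma frame_dotv_ge (v : 'rV[R]_n) : dotv v v <= \sum_c dotv v (w c) ^+ 2.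
Proof.
rewrite frame_dotvE.
set h := P^T *m P; set g := graph_metric u p.
have hT : h^T = h by rewrite trmx_mul trmxK.
have E : (v - v *m h) *m g *m (v - v *m h)^T =
    v *m g *m v^T - v *m v^T - (v *m v^T - v *m h *m v^T).
  rewrite [(v - _)^T]linearB /= trmx_mul hT !mulmxBl -[v *m h *m g]mulmxA.
  rewrite (PtP : h *m g = 1%:M) mulmx1 !mulmxBr.
  rewrite [v *m g *m (h *m _)]mulmxA -[v *m g *m h]mulmxA.
  by rewrite (gPtP : g *m h = 1%:M) mulmx1 [v *m (h *m _)]mulmxA.
have := metric_ge0 (v - v *m h); rewrite -/g E.
have := metric_le v; rewrite -/g dotv_mulmx.
have E2 (a b c : 'M[R]_1) : (a - b - (b - c)) 0 0 = a 0 0 - 2 * b 0 0 + c 0 0.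
  by rewrite !mxE; ring.
by rewrite E2; lra.
Qed.

(** The frame is chosen point by point with no continuity in [p]; the trace depends on the metric
    alone, so it is continuous and bounded on balls. *)
Lemma frame_sum_dotv : \sum_c dotv (w c) (w c) = \tr (invmx (graph_metric u p)).
Proof.
have gu : graph_metric u p \in unitmx.
  by rewrite unitmxE unitfE gt_eqF // posdef_det_gt0.
have -> : invmx (graph_metric u p) = P^T *m P.
  by rewrite -[RHS](mulKmx gu) gPtP mulmx1.
rewrite mxtrace_mulC; apply: eq_bigr => c _; rewrite [RHS]mxE.
by apply: eq_bigr => i _; rewrite !mxE.
Qed.

(** Transfers a lower bound along a fixed direction, available near a point by continuity, to the
    frame, which varies with [p]. The coordinates [z] of [v] in the frame have square sum
    [g(v, v) <= |v|^2], and Cauchy-Schwarz is used in each index. *)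
Lemma frame_hessian_ge a (v : 'rV[R]_n) : 'D_v ('D_v (U a)) p ^+ 2 <=
  dotv v v ^+ 2 * \sum_b \sum_c ('D_(w c) ('D_(w b) (U a)) p) ^+ 2.
Proof.
pose z := v *m graph_metric u p *m P^T.
have vE : v = z *m P.
  by rewrite /z -!mulmxA [P^T *m P]lock -lock gPtP mulmx1.
have zz : \sum_c z 0 c ^+ 2 <= dotv v v.
  apply: le_trans (metric_le v); rewrite le_eqVlt; apply/orP; left; apply/eqP.
  have -> : v *m graph_metric u p *m v^T = z *m z^T.
    by rewrite {2}vE trmx_mul /z !mulmxA.
  by rewrite mxE; apply: eq_bigr => c _; rewrite [z^T _ _]mxE -expr2.
have DzE k f x : Ck k.+1 f -> 'D_v f x = \sum_c z 0 c * 'D_(w c) f x.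
  move=> Hf; rewrite (congr1 (fun h => h x) (Ck_deriveE Hf v)) {1}vE.
  rewrite (eq_bigr (fun i => \sum_c z 0 c * (P c i * partial i f x))); last first.
    by move=> i _; rewrite mxE mulr_suml; apply: eq_bigr => c _; rewrite mulrA.
  rewrite exchange_big; apply: eq_bigr => c _; rewrite -mulr_sumr; congr (_ * _).
  rewrite (congr1 (fun h => h x) (Ck_deriveE Hf (w c))).
  by apply: eq_bigr => i _; rewrite [row c P _ _]mxE.
have E1 : 'D_v (U a) = fun x => \sum_b z 0 b * 'D_(w b) (U a) x.
  by apply/funext => x; exact: (DzE _ _ _ (u_smooth a 1)).
have E2 : 'D_v ('D_v (U a)) p = \sum_b z 0 b * 'D_v ('D_(w b) (U a)) p.
  apply: etrans (congr1 (fun h => 'D_v h p) E1) _.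
  have := is_derive_bigsum (index_enum 'I_n) (fun b => is_derive_cmul (z 0 b)
    (is_derive_DU u_smooth a (w b) v p)).
  by case.
have E3 : 'D_v ('D_v (U a)) p =
    \sum_b z 0 b * \sum_c z 0 c * 'D_(w c) ('D_(w b) (U a)) p.
  apply: (etrans E2); apply: eq_bigr => b _; congr (_ * _).
  exact: (DzE _ _ _ (Ck_derive (w b) (u_smooth a 2))).
rewrite E3; apply: le_trans (cauchy_schwarz_sum _ _ _) _.
pose Z := \sum_c z 0 c ^+ 2; rewrite -/Z in zz *.
have Z0 : 0 <= Z by apply: sumr_ge0 => *; exact: sqr_ge0.
apply: (@le_trans _ _ (Z * (Z * \sum_b \sum_c ('D_(w c) ('D_(w b) (U a)) p) ^+ 2))).
  apply: ler_wpM2l => //; rewrite mulr_sumr; apply: ler_sum => b _.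
  exact: cauchy_schwarz_sum.
rewrite mulrA -expr2; apply: ler_wpM2r.
  by apply: sumr_ge0 => b _; apply: sumr_ge0 => c _; rewrite sqr_ge0.
by rewrite ler_pXn2r ?nnegrE // (le_trans Z0).
Qed.

End Frame.

Lemma twice_derivable_neg_log_det : twice_derivable neg_log_det.
Proof.
(* The second derivative was computed only where the frame is orthonormal, so each point receives
   its own frame. *)
have [P HP] := choice (fun x => posdef_frame (g_posdef x)).
by split=> x v; [exact: derivable_neg_log_det (HP x) x v|
                 exact: derivable2_neg_log_det (HP x) v].
Qed.

Lemma differentiable_graph_metric x i j :
  differentiable (fun y => graph_metric u y i j) x.
Proof.
under eq_fun do rewrite mxE.
apply: differentiableB; first exact: differentiable_cst.
apply: differentiable_bigsum => a.
by apply: differentiableM; apply: (differentiable_DU u_smooth).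
Qed.

Lemma continuous_neg_log_det : continuous neg_log_det.
Proof.
move=> x; apply: differentiable_continuous; apply: differentiableN.
apply: differentiable_comp.
  exact: differentiable_det (differentiable_graph_metric x).
apply/derivable1_diffP.
by have [] := is_derive1_ln (posdef_det_gt0 (g_posdef x)).
Qed.

Lemma continuous_trace_invmx : continuous (fun x => \tr (invmx (graph_metric u x))).
Proof.
move=> x; apply: differentiable_continuous; apply: differentiable_bigsum => i.
apply: differentiable_invmx => [y|]; last exact: differentiable_graph_metric.
by rewrite unitmxE unitfE gt_eqF // posdef_det_gt0.
Qed.

End ShrinkerGraph.

(** * Maximum principle *)

Lemma half_le_of_close (R : realFieldType) (a b : R) :
  `|a - b| <= a / 2 -> a / 2 <= b.
Proof. by move=> /(le_trans (ler_norm _)) H; lra. Qed.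

Lemma square_bounded_below (R : realType) (n : nat) (f : 'rV[R]_n -> R) y :
  {for y, continuous f} -> f y != 0 ->
  exists2 r : R, 0 < r &
    forall p, dotv (p - y) (p - y) < r ^+ 2 -> f y ^+ 2 / 2 <= f p ^+ 2.
Proof.
move=> cf fy.
have k0 : 0 < f y ^+ 2 / 2.
  by rewrite divr_gt0 // lt_def sqrf_eq0 fy sqr_ge0.
have /cvgrPdist_le/(_ _ k0)/nbhs_ballP[r r0 Hr] := continuousM cf cf.
exists r => // p py; have /Hr /= H : ball y r p.
  rewrite -ball_normE /ball_ /= distrC; apply: le_lt_trans (normr_le_enorm _) _.
  by rewrite -(@ltr_pXn2r _ 2) ?nnegrE ?enorm_ge0 ?(ltW r0) // enorm_sqr.
exact: half_le_of_close H.
Qed.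

(** Near its centre the Gaussian may have negative [L], but not below [- 2 al M]; this [eps] costs
    the Hessian term [c] at most half. *)
Lemma gain_near (R : realFieldType) (al G M X eps c L : R) :
  0 <= al -> 0 <= G -> G <= 1 -> 0 <= M -> - M <= X -> 0 <= eps ->
  eps * (4 * al * M + 1) = c -> c <= L ->
  c / 2 <= eps * (2 * al * G * X) + L.
Proof.
move=> al0 G0 G1 M0 MX e0 E cL.
have H1 : 0 <= G * X + M.
  have -> : G * X + M = G * (X + M) + (1 - G) * M by ring.
  by rewrite addr_ge0 // mulr_ge0 // ?subr_ge0 // -lerBlDr sub0r.
have H2 : 0 <= eps * (al * (G * X + M)) by rewrite !mulr_ge0.
by lra.
Qed.

Lemma gain_far (R : realFieldType) (al E G X eps L : R) :
  0 <= al -> 0 <= E -> E <= G -> 1 <= X -> 0 <= eps -> 0 <= L ->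
  eps * (2 * al * E) <= eps * (2 * al * G * X) + L.
Proof.
move=> al0 E0 EG X1 e0 L0; have G0 := le_trans E0 EG.
rewrite -[leLHS]addr0 lerD // ler_wpM2l // -[leRHS]mulrA.
rewrite ler_wpM2l ?mulr_ge0 //; apply: le_trans EG _.
exact: ler_peMr.
Qed.

(** The penalty lowers [L] by at most [2 e k], which is less than [c3]. *)
Lemma gain_contradiction (R : realFieldType) (e k z c3 K L : R) :
  0 < e -> 0 <= k -> 0 <= z -> e * (4 * k + 1) <= c3 -> 0 < c3 ->
  c3 <= K + L -> - e * (2 * k - 2 * z) + (K + L) <= 0 -> False.
Proof.
move=> e0 k0 z0 H c30 H1 H2.
have H3 : 0 <= e * z by rewrite mulr_ge0 // ltW.
have H4 : 0 <= e * k by rewrite mulr_ge0 // ltW.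
by lra.
Qed.

Section Rigidity.
Context {R : realType} {n m : nat} (u : 'rV[R]_n -> 'rV[R]_m).
Context (u_smooth : smooth u).
Context (g_posdef : forall x : 'rV[R]_n, posdefmx (graph_metric u x)).
Context (u_eq : forall (x : 'rV[R]_n) (a : 'I_m),
    \sum_(i < n) \sum_(j < n)
      invmx (graph_metric u x) i j * partial j (partial i (component u a)) x
    = - component u a x + dotv x (gradient (component u a) x)).
Context (u0 : forall a : 'I_m, component u a 0 = 0).
Context (g_growth :
    ln (\det (graph_metric u x)) / enorm x @[x --> @enorm_pinfty R n]
      --> (0 : R)).
Local Notation U := (component u).
Local Notation phi := (neg_log_det u).
Local Notation z := (lorentz_sq u).

Lemma neg_log_det_growth (e C : R) : 0 < e ->
  exists r, forall x, r < enorm x -> phi x - e * z x <= C.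
Proof.
move=> e0.
have [c c0 zc] := lorentz_sq_growth u_smooth g_posdef u0.
(* Of the lower bound [e * c * |x|] for [e * z x], one half absorbs [phi] and the other the constant
   [C]. *)
have d0 : 0 < e * c / 2 by rewrite divr_gt0 ?mulr_gt0.
have /cvgrPdist_le/(_ _ d0)[r1 _ Hr1] := g_growth.
exists (Num.max (Num.max r1 1) (2 * `|C| / (e * c))) => x.
rewrite !gt_max => /andP[/andP[/Hr1 /= H1 x1] x2].
have xp : 0 < enorm x := lt_trans ltr01 x1.
have {}H1 : phi x <= e * c / 2 * enorm x.
  move: H1; rewrite sub0r normrN normrM normfV (gtr0_norm xp) ler_pdivrMr // => H1.
  by apply: le_trans H1; rewrite /neg_log_det -normrN ler_norm.
have H2 : e * (c * enorm x) <= e * z x by rewrite ler_pM2l //; apply: zc; apply: ltW.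
have H3 : `|C| <= e * c / 2 * enorm x.
  move: x2; rewrite ltr_pdivrMr ?mulr_gt0 // => x2.
  by lra.
have H4 : - `|C| <= C by rewrite lerNl -normrN ler_norm.
by lra.
Qed.

Opaque neg_log_det lorentz_sq gaussian.

(** The point [x0] maximizes [phi] on a ball fixed before [e], so the limit in [e] requires no
    convergence of the penalized maximum points. *)
Lemma neg_log_det_max : exists x0, forall x, phi x <= phi x0.
Proof.
have [c c0 zc] := lorentz_sq_growth u_smooth g_posdef u0.
(* Beyond this radius [z >= c |x| > n]; the maximum with 1 makes the linear bound on [z]
   available. *)
pose rho := Num.max 1 (n%:R / c).
have rho1 : 1 <= rho by rewrite le_max lexx.
have cphi : continuous phi := continuous_neg_log_det u_smooth g_posdef.
have cz : continuous z.
  by move=> x; apply: differentiable_continuous; apply: differentiable_lorentz_sq.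
have [||x0 _ x0max] := EVT_max_rV (f := phi) _ (@compact_eball R n (rho ^+ 2)).
- by exists 0; rewrite /= dotv00 sqr_ge0.
- exact: continuous_subspaceT.
exists x0 => x; apply/ler_addgt0Pr => d d0.
have zx0 : 0 <= z x := lorentz_sq_ge0 u_smooth g_posdef u0 x.
(* The penalty at the given [x] is then at most [d]. *)
pose e := d / (z x + 1).
have e0 : 0 < e by rewrite divr_gt0 // ltr_wpDl.
pose f x := - e * z x + phi x.
have [r Hr] := neg_log_det_growth (f 0) e0.
have [p pmax] : exists p, forall x, f x <= f p.
  apply: (@coercive_max _ _ f r).
    exact: continuous_axpy.
  have E y : phi y - e * z y = f y by rewrite /f mulNr addrC.
  by move=> y /Hr; rewrite E.
have [P HP] := posdef_frame (g_posdef p).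
have Tz := twice_derivable_lorentz_sq u_smooth.
have Tphi := twice_derivable_neg_log_det u_smooth g_posdef.
have := drift_laplacian_max P (twice_derivable_axpy (- e) Tz Tphi) pmax.
rewrite (drift_laplacian_axpy _ _ _ Tz Tphi).
rewrite (drift_laplacian_lorentz_sq u_smooth g_posdef u_eq HP) => Lf.
have Lphi : 0 <= drift_laplacian P phi p.
  apply: le_trans (drift_laplacian_neg_log_det u_smooth g_posdef u_eq HP).
  rewrite mulr_ge0 //; apply: sumr_ge0 => a _; apply: sumr_ge0 => b _.
  by apply: sumr_ge0 => k _; rewrite sqr_ge0.
have zp : z p <= n%:R.
  have ar (a b c' : R) : 0 <= c' -> - e * (2 * a - 2 * b) + c' <= 0 ->
    e * (b - a) <= 0 by clear; move=> *; lra.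
  by have := ar _ _ _ Lphi Lf; rewrite pmulr_rle0 // subr_le0.
have prho : enorm p <= rho.
  have [p1|p1] := leP (enorm p) 1; first exact: le_trans p1 rho1.
  rewrite le_max ler_pdivlMr // mulrC.
  by rewrite (le_trans (zc p (ltW p1)) zp) orbT.
have phip : phi p <= phi x0.
  apply: x0max; rewrite inE /= -enorm_sqr ler_pXn2r ?nnegrE ?enorm_ge0 //.
  exact: le_trans ler01 rho1.
have := pmax x; rewrite /f.
have zp0 : 0 <= e * z p by rewrite mulr_ge0 ?(ltW e0) // (lorentz_sq_ge0 u_smooth).
have ezx : e * z x <= d.
  rewrite /e mulrAC ler_pdivrMr ?ltr_wpDl // ler_pM2l //.
  by rewrite lerDl.
have ar (a b c' e' g h d' : R) : - e' * a + b <= - e' * c' + g -> 0 <= e' * c' ->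
  e' * a <= d' -> g <= h -> b <= h + d' by clear; move=> *; lra.
by move=> H; apply: (ar _ _ _ _ _ _ _ H zp0 ezx phip).
Qed.

Lemma hessian_eq0 (a : 'I_m) (v y : 'rV[R]_n) : 'D_v ('D_v (U a)) y = 0.
Proof.
apply/eqP/negP => /negP Hy.
pose k := 'D_v ('D_v (U a)) y ^+ 2.
have k0 : 0 < k by rewrite lt_def sqrf_eq0 Hy sqr_ge0.
have [r r0 Hr] : exists2 r : R, 0 < r & forall p, dotv (p - y) (p - y) < r ^+ 2 ->
    k / 2 <= 'D_v ('D_v (U a)) p ^+ 2.
  have cD := differentiable_continuous (differentiable_DDU u_smooth a v v y).
  exact: (@square_bounded_below _ _ ('D_v ('D_v (U a))) y cD Hy).
have [x0 x0max] := neg_log_det_max.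
(* The factor of [frame_hessian_ge], increased by 1 so that it can be divided by; [c1 / 2] then
   bounds the squared Hessian from below near [y]. *)
pose N := dotv v v ^+ 2 + 1.
have N0 : 0 < N by rewrite ltr_wpDl ?sqr_ge0.
pose c1 := k / N.
have c10 : 0 < c1 by rewrite divr_gt0.
(* Outside this ball the Gaussian is below its value at [x0] by the factor [expR (- al)], whereas
   [phi] is largest at [x0]. *)
pose rho := dotv (x0 - y) (x0 - y) + 1.
have rho0 : 0 <= rho by rewrite addr_ge0 ?dotv_ge0.
have [T T0 HT] : exists2 T : R, 0 <= T & forall p, dotv (p - y) (p - y) <= rho ->
    \tr (invmx (graph_metric u p)) <= T.
  pose B := (Num.sqrt rho + enorm y) ^+ 2.
  have [||q _ qmax] := EVT_max_rV (f := fun x => \tr (invmx (graph_metric u x))) _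
      (@compact_eball R n B).
  - by exists 0; rewrite /= dotv00 sqr_ge0.
  - apply: continuous_subspaceT.
    exact: (continuous_trace_invmx u_smooth g_posdef).
  exists `|\tr (invmx (graph_metric u q))| => // p py.
  apply: le_trans (ler_norm _); apply: qmax; rewrite inE /= -enorm_sqr.
  rewrite ler_pXn2r ?nnegrE ?addr_ge0 ?sqrtr_ge0 ?enorm_ge0 //.
  rewrite -{1}(subrK y p); apply: le_trans (enormD _ _) _.
  by rewrite lerD2r; apply: ler_wsqrtr.
pose M := T + dotv y y.
have M0 : 0 <= M by rewrite addr_ge0 ?dotv_ge0.
(* Makes [2 * al * q - M] at least 1 as soon as [q >= r ^+ 2], where the Hessian bound is lost. *)
pose al := (M + 1) / (2 * r ^+ 2).
have r20 : 0 < r ^+ 2 by rewrite exprn_gt0.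
have al0 : 0 < al by rewrite divr_gt0 ?mulr_gt0 // ltr_wpDl.
pose G := gaussian y al.
have G0 p : 0 < G p := gaussian_gt0 y al p.
have G1 p : G p <= 1 := gaussian_le1 y p (ltW al0).
pose c2 := 2 * al * expR (- (al * rho)).
have c20 : 0 < c2 by apply: mulr_gt0; [exact: mulr_gt0|exact: expR_gt0].
pose eps := c1 / (4 * al * M + 1).
have D0 : 0 < 4 * al * M + 1 by rewrite ltr_wpDl // mulr_ge0 // mulr_ge0 // ltW.
have eps0 : 0 < eps by rewrite divr_gt0.
pose c3 := Num.min (c1 / 2) (eps * c2).
have c30 : 0 < c3 by rewrite lt_min; apply/andP; split; [exact: divr_gt0|exact: mulr_gt0].
pose th := expR (- al).
have th1 : th < 1 by rewrite -expR0 ltr_expR oppr_lt0.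
have Tz := twice_derivable_lorentz_sq u_smooth.
have Tphi := twice_derivable_neg_log_det u_smooth g_posdef.
have TG : twice_derivable G := twice_derivable_gaussian y al.
have TGphi := twice_derivable_axpy eps TG Tphi.
have z0 x : 0 <= z x := lorentz_sq_ge0 u_smooth g_posdef u0 x.
(* The first bound keeps [L] of the penalized function positive in the ball; the second keeps the
   penalty at [x0] below the advantage of the Gaussian there over its values outside the ball. *)
pose e := Num.min (c3 / (4 * n%:R + 1)) (eps * (1 - th) * G x0 / (2 * (z x0 + 1))).
have n40 : 0 < 4 * n%:R + 1 :> R by rewrite ltr_wpDl // mulr_ge0.
have zx01 : 0 < 2 * (z x0 + 1) by rewrite mulr_gt0 // ltr_wpDl.
have e0 : 0 < e.
  rewrite lt_min; apply/andP; split; first exact: divr_gt0.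
  apply: divr_gt0 => //; apply: mulr_gt0 => //; apply: mulr_gt0 => //.
  by rewrite subr_gt0.
have cphi : continuous phi := continuous_neg_log_det u_smooth g_posdef.
have cz : continuous z.
  by move=> x; apply: differentiable_continuous; apply: differentiable_lorentz_sq.
have cG : continuous G := @continuous_gaussian _ _ y al.
pose f x := - e * z x + (eps * G x + phi x).
(* The Gaussian term adds at most [eps]. *)
have [s Hs] := neg_log_det_growth (f 0 - eps) e0.
have [p pmax] : exists p, forall x, f x <= f p.
  apply: (@coercive_max _ _ f s).
    by apply: continuous_axpy => //; exact: continuous_axpy.
  have ar (a' b c d e' h : R) : a' - e' * b <= h - d -> c <= d ->
    - e' * b + (c + a') <= h by clear; move=> *; lra.
  move=> x /Hs H; apply: (ar _ _ _ _ _ _ H).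
  by rewrite -[leRHS]mulr1 ler_pM2l.
have py : dotv (p - y) (p - y) <= rho.
  rewrite leNgt; apply/negP => far.
  have Gp : G p <= th * G x0.
    by apply: gaussian_decay; rewrite ltW.
  have H1 : 0 <= e * z p by rewrite mulr_ge0 // ltW.
  have H2 : eps * G p <= eps * (th * G x0) by rewrite ler_pM2l.
  have H3 : e * (2 * (z x0 + 1)) <= eps * (1 - th) * G x0.
    by rewrite -ler_pdivlMr // ge_min lexx orbT.
  have H4 : 0 <= e * z x0 by rewrite mulr_ge0 // ltW.
  have ar (e' a' b c d g h E t : R) : 0 < e' ->
    - e' * a' + (E * b + c) <= - e' * d + (E * g + h) ->
    h <= c -> 0 <= e' * d -> E * g <= E * (t * b) ->
    e' * (2 * (a' + 1)) <= E * (1 - t) * b -> 0 <= e' * a' -> False.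
    by clear; move=> *; lra.
  exact: (ar _ _ _ _ _ _ _ _ _ e0 (pmax x0) (x0max p) H1 H2 H3 H4).
have [P HP] := posdef_frame (g_posdef p).
have := drift_laplacian_max P (twice_derivable_axpy (- e) Tz TGphi) pmax.
rewrite (drift_laplacian_axpy _ _ _ Tz TGphi) (drift_laplacian_axpy _ _ _ TG Tphi).
rewrite (drift_laplacian_lorentz_sq u_smooth g_posdef u_eq HP) drift_laplacian_gaussian.
rewrite (frame_sum_dotv g_posdef HP).
set q := dotv (p - y) (p - y) in py *.
have Sq : q <= \sum_c dotv (p - y) (row c P) ^+ 2.
  exact: (frame_dotv_ge u_smooth g_posdef HP).
have WT : \tr (invmx (graph_metric u p)) <= T by exact: HT.
have dY : - dotv y y <= dotv (p - y) p := dotv_sub_ge p y.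
have HL := drift_laplacian_neg_log_det u_smooth g_posdef u_eq HP.
have Hess : 'D_v ('D_v (U a)) p ^+ 2 / N <=
    \sum_a0 \sum_b \sum_c 'D_(row c P) ('D_(row b P) (U a0)) p ^+ 2.
  rewrite ler_pdivrMr // [leRHS]mulrC.
  apply: le_trans (frame_hessian_ge u_smooth HP a v) _.
  apply: ler_pM; rewrite ?sqr_ge0 ?lerDl //.
    by apply: sumr_ge0 => b _; apply: sumr_ge0 => c _; rewrite sqr_ge0.
  rewrite [leRHS](bigD1 a) //= lerDl; apply: sumr_ge0 => a0 _.
  by apply: sumr_ge0 => b _; apply: sumr_ge0 => c _; rewrite sqr_ge0.
have Hess0 : 0 <= \sum_a0 \sum_b \sum_c 'D_(row c P) ('D_(row b P) (U a0)) p ^+ 2.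
  apply: sumr_ge0 => a0 _.
  by apply: sumr_ge0 => b _; apply: sumr_ge0 => c _; rewrite sqr_ge0.
have Hrp := Hr p; rewrite -/q in Hrp.
have Gp : expR (- (al * rho)) <= G p by apply: gaussian_ge; [exact: ltW|exact: py].
have q0 : 0 <= q := dotv_ge0 _.
have zp0 := z0 p; have Gp0 := ltW (G0 p); have Gp1 := G1 p.
rewrite -/(G p).
move: (G p) Gp Gp0 Gp1 => Gp GpE Gp0 Gp1.
move: (dotv (p - y) p) dY (\tr _) WT (\sum_c _) Sq => dd dY W WT S Sq.
move: (\sum_a0 _) HL Hess Hess0 => Q.
move: (drift_laplacian P phi p) => Lphi HL Hess Hess0 Lf.
move: ('D_v _ p) Hrp Hess => Dvv Hrp Hess.
have X1 : 2 * al * q - M <= 2 * al * S - W + dd.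
  have : 2 * al * q <= 2 * al * S by rewrite ler_pM2l // mulr_gt0.
  by move=> H; rewrite /M opprD addrA lerD // lerB.
have epsE : eps * (4 * al * M + 1) = c1 by rewrite /eps divfK // gt_eqF.
have key : c3 <= eps * (2 * al * Gp * (2 * al * S - W + dd)) + Lphi.
  have [qr|qr] := ltP q (r ^+ 2).
    apply: (@le_trans _ _ (c1 / 2)); first by rewrite ge_min lexx.
    apply: (gain_near (ltW al0) Gp0 Gp1 M0 _ (ltW eps0) epsE).
      apply: le_trans X1; rewrite lerDr.
      by rewrite mulr_ge0 // mulr_ge0 // ltW.
    apply: le_trans HL.
    have : k / 2 / N <= Q by apply: le_trans Hess; rewrite ler_pM2r ?invr_gt0 // Hrp.
    by rewrite mulrAC -/c1 ler_pdivrMr // mulrC.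
  apply: (@le_trans _ _ (eps * c2)); first by rewrite ge_min lexx orbT.
  apply: (gain_far (ltW al0) (expR_ge0 _) GpE _ (ltW eps0)).
    apply: le_trans X1; rewrite lerBrDr addrC.
    have -> : M + 1 = 2 * al * r ^+ 2 by rewrite /al; field; rewrite gt_eqF.
    by rewrite ler_pM2l // mulr_gt0.
  by apply: le_trans HL; rewrite mulr_ge0.
have e4 : e * (4 * n%:R + 1) <= c3 by rewrite -ler_pdivlMr // ge_min lexx.
exact: (gain_contradiction e0 (ler0n R n) zp0 e4 c30 key Lf).
Qed.

End Rigidity.

(** * Linearity of the graph *)

Unset Implicit Arguments.

Theorem theorem3 (R : realType) (n m : nat) (hn : (1 <= n)%N) (hm : (1 <= m)%N)
  (u : 'rV[R]_n -> 'rV[R]_m)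
  (u_smooth : smooth u)
  (g_posdef : forall x : 'rV[R]_n, posdefmx (graph_metric u x))
  (u_eq : forall (x : 'rV[R]_n) (a : 'I_m),
    \sum_(i < n) \sum_(j < n)
      invmx (graph_metric u x) i j * partial j (partial i (component u a)) x
    = - component u a x + dotv x (gradient (component u a) x))
  (u0 : forall a : 'I_m, component u a 0 = 0)
  (g_growth :
    ln (\det (graph_metric u x)) / enorm x @[x --> @enorm_pinfty R n]
      --> (0 : R)) :
  exists V : {vspace 'rV[R]_(n + m)}, graph u = [set p | p \in V].
Proof.
pose B : 'M[R]_(n, m) := \matrix_(i, a) partial i (component u a) 0.
have uE x : u x = x *m B.
  apply/rowP => a.
  have -> : (x *m B) 0 a = 'D_x (component u a) 0.
    by rewrite (deriveUE u_smooth) mxE; apply: eq_bigr => i _; rewrite mxE.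
  have dU y := @diff_derivable _ _ _ _ y x (differentiable_U u_smooth a y).
  have dDU y := @diff_derivable _ _ _ _ y x (differentiable_DU u_smooth a x y).
  have [t [_ E1]] := MVT_dir 0 1 dU.
  have [s [_ E2]] := MVT_dir 0 (t * 1) dDU.
  rewrite (hessian_eq0 u_smooth g_posdef u_eq u0 g_growth) mulr0 in E2.
  move/eqP: E2; rewrite subr_eq0 => /eqP E2.
  by move: E1; rewrite u0 subr0 add0r scale1r mul1r E2.
exists (limg (linfun (mulmxr (row_mx 1%:M B)))).
apply/seteqP; split => [_ [x _ <-]|p /= /memv_imgP[x _ ->]].
  have -> : row_mx x (u x) = linfun (mulmxr (row_mx 1%:M B)) x.
    by rewrite lfunE /= mul_mx_row mulmx1 uE.
  exact: memv_img (memvf x).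
by exists x => //; rewrite lfunE /= mul_mx_row mulmx1 uE.
Qed.
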